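(* Let $S$ be a regular elliptical surface. Then the 1-forms $w_1,w_2$ together with the functions $I_{40},I_{31},I_{22}$ are a complete set of affine differential invariants of $S$. That is: let $S,S'$ be connected regular elliptical surfaces in $A^3$, each equipped with a smooth affine moving frame as described in the context, with associated data $(w_1,w_2,I_{40},I_{31},I_{22})$ and $(w_1',w_2',I_{40}',I_{31}',I_{22}')$. If $F:S\to S'$ is a diffeomorphism with $F^*w_1'=w_1$, $F^*w_2'=w_2$, $I_{40}'\circ F=I_{40}$, $I_{31}'\circ F=I_{31}$, $I_{22}'\circ F=I_{22}$, then $F$ is the restriction to $S$ of an element of $Aff(3)$. Conversely, if $T\in Aff(3)$ satisfies $T(S)=S'$ and $S'$ is equipped with the image under $T$ of the moving frame of $S$, then $F=T|_S$ satisfies these equalities.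
   Context: $A^3$ is real affine 3-space, $Aff(3)$ the group of all affine transformations of $A^3$; surfaces are smooth. A surface $S\subset A^3$ is called regular elliptical if for every $P\in S$ there is an affine frame $(e_1,e_2,e_3)$ (a basis of $\mathbb{R}^3$) with origin $P$ such that, in the affine coordinates $(x,y,z)\leftrightarrow P+xe_1+ye_2+ze_3$, $S$ is near $P$ the graph of a function with Taylor expansion $$z=\tfrac12(x^2+y^2)+\tfrac16(x^3-3xy^2)+\sum_{n\ge 4}\frac1{n!}\sum_{i+j=n}I_{ij}\binom{n}{i}x^iy^j .$$ At each point this frame is unique up to a finite group (isomorphic to the dihedral group of order 6, acting linearly on $(x,y)$ and trivially on $z$). A moving frame on $S$ is a smooth choice of such a frame $(e_1,e_2,e_3,r)$, where $r$ is the position vector of the point of $S$; it always exists locally. The coefficients $I_{ij}$ ($i+j\ge4$) are then functions on $S$, and the 1-forms $w_1,w_2$ on $S$ are defined by $dr=w_1e_1+w_2e_2$. *)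

(* Defs.v *)
From mathcomp Require Import all_boot all_order all_algebra.
From mathcomp Require Import all_classical all_reals all_analysis.

Set Implicit Arguments.
Unset Strict Implicit.
Unset Printing Implicit Defensive.
Import Order.TTheory GRing.Theory Num.Theory.
Import numFieldNormedType.Exports.

Local Open Scope classical_set_scope.
Local Open Scope ring_scope.

Section Smoothness.
Context {R : realType} {V W : normedModType R}.

(* C^k on an open set U; in this file V is always finite-dimensional, where
   this agrees with the definition by continuous partial derivatives. *)
Fixpoint C_k (k : nat) (U : set V) (f : V -> W) : Prop :=
  match k with
  | 0 => forall x, U x -> {for x, continuous f}
  | k'.+1 => (forall x, U x -> differentiable f x) /\
             (forall v : V, C_k k' U ('D_v f))
  end.

Definition smooth_at (x : V) (f : V -> W) : Prop :=
  exists2 U : set V, open_nbhs x U & forall k, C_k k U f.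

Definition local_extension (S : set V) (f : V -> W) (P : V) : set (V -> W) :=
  [set g | smooth_at P g /\ \forall Q \near P, S Q -> g Q = f Q].

(* A map on a subset S is represented by a total function whose values
   outside S are irrelevant. *)
Definition smooth_on (S : set V) (f : V -> W) : Prop :=
  forall P, S P -> exists g, local_extension S f P g.

(* The differential at P of a smooth map on a submanifold S: the differential
   of a local extension.  On vectors tangent to S it does not depend on the
   extension; on other vectors it is meaningless. *)
Definition surf_diff (S : set V) (f : V -> W) (P v : V) : W :=
  'd (get (local_extension S f P)) P v.

End Smoothness.

Section Surfaces.
Context {R : realType}.
Implicit Types (S : set 'rV[R]_3) (P Q v : 'rV[R]_3).

Definition tangent S P : set 'rV[R]_3 :=
  [set v | exists c : R -> 'rV[R]_3,
     [/\ smooth_at 0 c, c 0 = P, \forall t \near 0, S (c t) & 'D_1 c 0 = v]].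

Definition diffeomorphism S S' (F : 'rV[R]_3 -> 'rV[R]_3) : Prop :=
  smooth_on S F /\
  exists G : 'rV[R]_3 -> 'rV[R]_3,
    [/\ smooth_on S' G,
        forall P, S P -> S' (F P) /\ G (F P) = P &
        forall Q, S' Q -> S (G Q) /\ F (G Q) = Q].

(* The degree-n homogeneous part at (x, y) of the Taylor expansion of f at the
   origin. *)
Definition taylor_part (f : R * R -> R) (n : nat) (x y : R) : R :=
  \sum_(i < n.+1)
    iter i (fun g => 'D_((1, 0) : R * R) g)
      (iter (n - i) (fun g => 'D_((0, 1) : R * R) g) f) (0, 0)
    / (i`! * (n - i)`!)%:R * x ^+ i * y ^+ (n - i).

Definition normal_part (I : nat -> nat -> R) (n : nat) (x y : R) : R :=
  match n with
  | 0 | 1 => 0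
  | 2 => 2^-1 * (x ^+ 2 + y ^+ 2)
  | 3 => 6^-1 * (x ^+ 3 - 3 * x * y ^+ 2)
  | _ => (n`!)%:R^-1 *
         \sum_(i < n.+1) I i (n - i)%N * 'C(n, i)%:R * x ^+ i * y ^+ (n - i)
  end.

(* Frames are matrices: e_1, e_2, e_3 are the rows of E, so that the point with
   affine coordinates q = (x, y, z) with respect to (E, P) is P + q *m E. *)
Definition is_graph_near S P (E : 'M[R]_3) (f : R * R -> R) : Prop :=
  \forall q \near (0 : 'rV[R]_3), S (P + q *m E) <-> q 0 2 = f (q 0 0, q 0 1).

(* I i j is only significant for i + j >= 4. *)
Definition normal_form S P (E : 'M[R]_3) (I : nat -> nat -> R) : Prop :=
  E \in unitmx /\
  exists f : R * R -> R,
    [/\ smooth_at (0, 0) f, is_graph_near S P E f &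
        forall n x y, taylor_part f n x y = normal_part I n x y].

(* Being locally the graph of a smooth function makes S a smooth (embedded)
   surface. *)
Definition regular_elliptical S : Prop :=
  forall P, S P -> exists E I, normal_form S P E I.

Definition moving_frame S (E : 'rV[R]_3 -> 'M[R]_3) : Prop :=
  smooth_on S E /\ forall P, S P -> exists I, normal_form S P (E P) I.

(* A 1-form on S: only the values w P v with S P and v tangent to S at P are
   significant. *)
Definition one_form := 'rV[R]_3 -> 'rV[R]_3 -> R.

(* dr = w_1 e_1 + w_2 e_2, where dr is the inclusion of the tangent plane of S
   into R^3; this determines w_1 and w_2 on S. *)
Definition dual_forms S (E : 'rV[R]_3 -> 'M[R]_3) (w1 w2 : one_form) : Prop :=
  forall P v, S P -> tangent S P v ->
    v = w1 P v *: row 0 (E P) + w2 P v *: row 1 (E P).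

Definition coefficients S (E : 'rV[R]_3 -> 'M[R]_3)
    (I : 'rV[R]_3 -> nat -> nat -> R) : Prop :=
  forall P, S P -> normal_form S P (E P) (I P).

Definition pullback S (F : 'rV[R]_3 -> 'rV[R]_3) (w : one_form) : one_form :=
  fun P v => w (F P) (surf_diff S F P v).

Definition form_eq S (w w' : one_form) : Prop :=
  forall P v, S P -> tangent S P v -> w P v = w' P v.

Definition preserves_invariants S (F : 'rV[R]_3 -> 'rV[R]_3)
    (w1 w2 : one_form) (I : 'rV[R]_3 -> nat -> nat -> R)
    (w1' w2' : one_form) (I' : 'rV[R]_3 -> nat -> nat -> R) : Prop :=
  [/\ form_eq S (pullback S F w1') w1,
      form_eq S (pullback S F w2') w2,
      forall P, S P -> I' (F P) 4%N 0%N = I P 4%N 0%N,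
      forall P, S P -> I' (F P) 3%N 1%N = I P 3%N 1%N &
      forall P, S P -> I' (F P) 2%N 2%N = I P 2%N 2%N].

(* The elements of Aff(3) are the maps aff A b with A \in unitmx. *)
Definition aff (A : 'M[R]_3) (b P : 'rV[R]_3) : 'rV[R]_3 := P *m A + b.

(* The frame at T P is the image of the frame at P under the linear part A of
   T = aff A b. *)
Definition image_frame (A : 'M[R]_3) (b : 'rV[R]_3) (E : 'rV[R]_3 -> 'M[R]_3) :
    'rV[R]_3 -> 'M[R]_3 :=
  fun Q => E ((Q - b) *m invmx A) *m A.

End Surfaces.

(* Main.v *)
Require Import Defs.
From mathcomp Require Import all_boot all_order all_algebra.
From mathcomp Require Import all_classical all_reals all_analysis.
From mathcomp Require Import perm ring lra.
Import Order.TTheory GRing.Theory Num.Theory.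
Import numFieldNormedType.Exports.
Local Open Scope classical_set_scope.
Local Open Scope ring_scope.
Set Implicit Arguments.
Unset Strict Implicit.
Unset Printing Implicit Defensive.

(* Write [dE = Om E] for the connection matrix of the moving frame.  Near [P]
   the surface is the graph of one function [f]; at each nearby point it is also
   the graph, in the frame there, of a function whose 3-jet is the fixed normal
   one.  Comparing the two descriptions to order 3 and differentiating at [P] in
   a direction [w1 e1 + w2 e2] gives linear equations which express [Om] through
   [w1], [w2] and the coefficients of order 4.

   If [F] preserves the forms, then [dF = dr K] with [K = E^-1 (E' o F)].
   Symmetry of the second derivatives of [r] and of [F o r] says that the first
   row of [Om' - Om] at [e2] equals its second row at [e1]; with the linear
   equations and the equality of [I40], [I31], [I22] this forces [I13] and [I04]
   to agree and [Om' = Om].  Hence [dK = 0], so [K] is a constant matrix [A] by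
   connectedness, and then [F - r A] has zero differential and is constant. *)

(** * Differentials of matrix-valued maps *)

Section Differentials.
Context {R : realType}.
Implicit Types V W : normedModType R.

(** The connection involves all five coefficients of order 4, while only three are given. The other
    two are hidden in the forms: since the exterior derivative of [dr] vanishes, [dw1] and [dw2] are
    read off the row [Om 0] at [e2] minus the row [Om 1] at [e1], whose entries are [2/3 I13] and
    [(3 I40 - 6 I22 - I04) / 12]. Exterior derivatives of forms that are meaningful only on [S] are
    avoided by comparing second derivatives of [r] and [F o r] in one chart.

    The connection is computable because the 3-jet of the normal form is the same at every point:
    the motion of the frame has to compensate the change of the jet of [f], and the change of its
    third-order part is where order 4 enters. Degrees 1, 2 and 3 give 2 + 3 + 4 equations for the
    nine entries of [Om].

    The graph functions at different points are unrelated existential witnesses, with no known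
    smooth dependence on the point. They enter only through identities at each single point; what is
    differentiated along the surface is [f] and the frame. *)

Lemma is_diff_comp_fun V W (X : normedModType R) (f : V -> W) df (g : W -> X) dg x :
  is_diff x f df -> is_diff (f x) g dg ->
  is_diff x (fun y => g (f y)) (fun h => dg (df h)).
Proof. exact: is_diff_comp. Qed.

Lemma is_diff_eq_near V W (f g : V -> W) df x :
  (\forall y \near x, f y = g y) -> is_diff x f df -> is_diff x g df.
Proof.
move=> fg [fx <-].
have gE : g \o shift x = cst (g x) + 'd f x +o_ (0 : V) id.
  apply/eqaddoP => e e0.
  have /diff_locally/eqaddoP/(_ e e0) := fx.
  have fg0 : \forall h \near (0 : V), f (h + x) = g (h + x).
    by move: fg; rewrite (near_shift 0)/= subr0.
  apply: filterS2 fg0 => h.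
  by rewrite !fctE /= -(nbhs_singleton fg) => ->.
have dgE : 'd g x = 'd f x :> (V -> W).
  by apply: diff_unique => //; exact: diff_continuous.
apply: DiffDef => //; apply/diff_locallyP; rewrite dgE; split => //.
exact: diff_continuous.
Qed.

Lemma is_diff_ext V W (f : V -> W) df dg x :
  is_diff x f df -> df =1 dg -> is_diff x f dg.
Proof. by move=> fx /funext <-. Qed.

Lemma is_diffZl V W (k : V -> R) dk (a : W) x :
  is_diff x k dk -> is_diff x (fun y => k y *: a) (fun h => dk h *: a).
Proof.
move=> [kx <-]; apply: DiffDef; first exact: differentiableZl.
exact: diffZl.
Qed.

Lemma is_diff_bigsum V W (I : Type) (r : seq I) (f df : I -> V -> W) x :
  (forall i, is_diff x (f i) (df i)) ->
  is_diff x (fun y => \sum_(i <- r) f i y) (fun h => \sum_(i <- r) df i h).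
Proof.
move=> fx; elim: r => [|i r IHr].
  under eq_fun do rewrite big_nil;
    under [X in is_diff _ _ X]eq_fun do rewrite big_nil.
  exact: is_diff_cst.
under eq_fun do rewrite big_cons; under [X in is_diff _ _ X]eq_fun do rewrite big_cons.
exact: is_diffD.
Qed.

Lemma is_diff_coord m n (A : 'M[R]_(m, n)) i j :
  is_diff A (fun B : 'M[R]_(m, n) => B i j : R) (fun B => B i j).
Proof.
have @f : {linear 'M[R]_(m, n) -> R}.
  by exists (fun N : 'M[R]_(_, _) => N i j); do 2![eexists]; do ?[constructor];
     rewrite ?mxE// => ? *; rewrite ?mxE//; move=> ?; rewrite !mxE.
have cf : continuous f by exact: coord_continuous.
apply: DiffDef; first exact: differentiable_coord.
exact: (diff_lin A cf).
Qed.

(** A matrix is the finite sum of its entries times the [delta_mx i j], so matrix calculus reduces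
    to scalar calculus. *)
Lemma is_diff_mxP V m n (A dA : V -> 'M[R]_(m, n)) x :
  is_diff x A dA <->
  forall i j, is_diff x (fun y => A y i j : R) (fun h => dA h i j).
Proof.
split=> [Ax i j|Ax]; first exact: is_diff_comp_fun (is_diff_coord _ _ _).
have E (B : V -> 'M[R]_(m, n)) :
    B = fun y => \sum_i \sum_j B y i j *: delta_mx i j.
  by apply/funext => y; exact: matrix_sum_delta.
rewrite (E A) (E dA).
by apply: is_diff_bigsum => i; apply: is_diff_bigsum => j; exact: is_diffZl.
Qed.

Lemma is_diff_mulR V (f df g dg : V -> R) x :
  is_diff x f df -> is_diff x g dg ->
  is_diff x (fun y => f y * g y) (fun h => f x * dg h + g x * df h).
Proof. by move=> fx gx; exact: is_diffM. Qed.

Lemma is_diff_mulmx V m n p (A dA : V -> 'M[R]_(m, n)) (B dB : V -> 'M[R]_(n, p))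
    x :
  is_diff x A dA -> is_diff x B dB ->
  is_diff x (fun y => A y *m B y) (fun h => dA h *m B x + A x *m dB h).
Proof.
move=> /is_diff_mxP Ax /is_diff_mxP Bx; apply/is_diff_mxP => i j.
under eq_fun do rewrite mxE.
apply: is_diff_ext.
  by apply: is_diff_bigsum => k; apply: is_diff_mulR.
move=> h; rewrite !mxE -big_split/=; apply: eq_bigr => k _.
by rewrite /= addrC; congr (_ + _); exact: mulrC.
Qed.

Lemma differentiable_prodR V (I : Type) (r : seq I) (f : I -> V -> R) x :
  (forall i, differentiable (f i) x) ->
  differentiable (fun y => \prod_(i <- r) f i y) x.
Proof.
move=> fx; elim: r => [|i r IHr].
  by under eq_fun do rewrite big_nil; exact: differentiable_cst.
under eq_fun do rewrite big_cons.
exact: differentiableM.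
Qed.

Lemma differentiable_det V n (A : V -> 'M[R]_n) x :
  (forall i j, differentiable (fun y => A y i j : R) x) ->
  differentiable (fun y => \det (A y)) x.
Proof.
move=> Ax; rewrite /determinant.
have H (s : {perm 'I_n}) : is_diff x (fun y => (-1) ^+ s * \prod_i A y i (s i))
    ('d (fun y => (-1) ^+ s * \prod_i A y i (s i)) x).
  apply: differentiableP; apply: (@differentiableZ _ _ _ _ ((-1) ^+ s)).
  by apply: differentiable_prodR => i; exact: Ax.
have := is_diff_bigsum (index_enum _) H.
by case.
Qed.

(** Cramer's formula gives differentiability; the value of the differential then comes from
    differentiating [invmx (A y) *m A y = 1]. *)
Lemma is_diff_invmx V n (A dA : V -> 'M[R]_n) x :
  A x \in unitmx -> is_diff x A dA ->
  is_diff x (fun y => invmx (A y))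
    (fun h => - (invmx (A x) *m dA h *m invmx (A x))).
Proof.
move=> uA Ax; have /is_diff_mxP Aij := Ax.
have Aij' i j : differentiable (fun y => A y i j : R) x by have [] := Aij i j.
have dx0 : \det (A x) != 0 by rewrite -unitfE -unitmxE.
have ddet : differentiable (fun y => \det (A y)) x by exact: differentiable_det.
(* On singular matrices [invmx] is the identity, so both formulas are available only in a
   neighbourhood where [A y] stays invertible. *)
have u_near : \forall y \near x, A y \in unitmx.
  have /differentiable_continuous/cvgr_neq0 := ddet.
  by move=> /(_ dx0); apply: filterS => y; rewrite unitmxE unitfE.
have dinv : differentiable (fun y => invmx (A y)) x.
  have D i j : is_diff x (fun y => (\det (A y))^-1 * (\adj (A y)) i j)
      ('d (fun y => (\det (A y))^-1 * (\adj (A y)) i j) x).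
    apply: differentiableP; apply: differentiableM; first exact: differentiableV.
    under eq_fun do rewrite mxE.
    apply: (@differentiableZ _ _ _ _ ((-1) ^+ (j + i))).
    apply: differentiable_det => k l.
    by under eq_fun do rewrite !mxE; exact: Aij'.
  pose dB h := \matrix_(i, j) 'd (fun y => (\det (A y))^-1 * (\adj (A y)) i j) x h.
  suff [] : is_diff x (fun y => invmx (A y)) dB by [].
  apply: (@is_diff_eq_near _ _ (fun y => (\det (A y))^-1 *: \adj (A y))).
    by apply: filterS u_near => y; rewrite /invmx => ->.
  apply/is_diff_mxP => i j; under eq_fun do rewrite mxE.
  by apply: is_diff_ext (D i j) _ => h; rewrite mxE.
have [_ d1] := is_diff_mulmx (differentiableP dinv) Ax.
have [_ d0] : is_diff x (fun y => invmx (A y) *m A y) 0.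
  apply: (@is_diff_eq_near _ _ (cst 1%:M)).
  by apply: filterS u_near => y uy; rewrite mulVmx.
apply: is_diff_ext (differentiableP dinv) _ => h.
have E := congr1 (fun g : V -> 'M[R]_n => g h) (etrans (esym d1) d0).
cbv beta in E.
have z0 : (0 : V -> 'M[R]_n) h = 0 by [].
rewrite z0 in E.
have {}E := congr1 (mulmxr (invmx (A x))) E.
move: E; rewrite /= mulmxDl mulmxK// mul0mx => /eqP; rewrite addr_eq0 => /eqP ->.
by [].
Qed.

Lemma is_derive_is_diff W (c : R -> W) (t : R) v :
  is_derive t 1 c v <-> is_diff t c (fun h => h *: v).
Proof.
split=> [[/derivable1_diffP ct <-]|[ct dct]].
  by apply: is_diff_ext (differentiableP ct) _ => h; rewrite diff1E// derive1E.
apply: DeriveDef; first exact/derivable1_diffP.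
by rewrite deriveE// dct scale1r.
Qed.

Lemma is_derive_comp_curve V W (f : V -> W) df (c : R -> V) (t : R) v :
  is_diff (c t) f df -> is_derive t 1 c v ->
  is_derive t 1 (fun s => f (c s)) (df v).
Proof.
move=> fx /is_derive_is_diff cx; apply/is_derive_is_diff.
have := is_diff_comp_fun cx fx; have [ft <-] := fx => H.
by apply: is_diff_ext H _ => h; rewrite linearZ.
Qed.

Lemma is_derive_comp_at V W (f : V -> W) df x (c : R -> V) (t : R) v :
  is_diff x f df -> c t = x -> is_derive t 1 c v ->
  is_derive t 1 (fun s => f (c s)) (df v).
Proof. by move=> fx ctx; rewrite -ctx in fx; exact: is_derive_comp_curve. Qed.

End Differentials.

(** * Symmetry of second derivatives *)

Section MixedPartials.
Context {R : realType} {V : normedModType R}.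
Implicit Types (h : V -> R) (x u v : V).

Lemma is_derive_line h x u (t : R) :
  derivable h (x + t *: u) u ->
  is_derive t 1 (fun s => h (x + s *: u)) ('D_u h (x + t *: u)).
Proof.
move=> hu.
have E : (fun s : R => s^-1 *: (h (s *: u + (x + t *: u)) - h (x + t *: u))) =
  (fun s : R => s^-1 *: (h (x + (s *: (1 : R) + t) *: u) - h (x + t *: u))).
  apply/funext => s; congr (_ *: (h _ - _)).
  by rewrite scalerDl -[s *: 1]/(s * 1) mulr1 addrCA.
apply: DeriveDef; first by rewrite /derivable -E.
by rewrite /derive -E.
Qed.

(** The mean value theorem in the direction [u] turns the second difference into [t] times a
    difference of two values of ['D_u h], and differentiability of ['D_u h] at [x] expands both
    values to first order. *)
Lemma second_difference_estimate h x u v :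
  (\forall y \near x, derivable h y u) -> differentiable ('D_u h) x ->
  forall e : R, 0 < e -> \forall t \near (0 : R)^'+,
    `|h (x + t *: u + t *: v) - h (x + t *: u) - h (x + t *: v) + h x
      - t ^+ 2 * 'd ('D_u h) x v| <= e * t ^+ 2.
Proof.
move=> hu gx e e0.
(* The two expansions err in proportion to the norms of [s *: u + t *: v] and [s *: u], together at
   most [t * (2 * |u| + |v|)]; the summand 1 makes [K] positive. *)
pose K := 2 * `|u| + `|v| + 1.
have K0 : 0 < K by rewrite /K ltr_wpDl// addr_ge0// mulr_ge0.
have eK0 : 0 < e / K by rewrite divr_gt0.
have G : \forall y \near (0 : V),
    `|'D_u h (x + y) - 'D_u h x - 'd ('D_u h) x y| <= e / K * `|y|.
  have /diff_locally/eqaddoP/(_ _ eK0) := gx; apply: filterS => y.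
  by rewrite !fctE /= opprD addrA [y + x]addrC.
have H : \forall y \near (0 : V), derivable h (x + y) u.
  move: hu; rewrite (near_shift 0)/= subr0; apply: filterS => y.
  by rewrite /= addrC.
have /nbhs_ballP[r /= r0 rP] : \forall y \near (0 : V),
  `|'D_u h (x + y) - 'D_u h x - 'd ('D_u h) x y| <= e / K * `|y| /\
  derivable h (x + y) u by apply: filterS2 G H.
have small t a b : 0 < t -> t < r / K -> 0 <= a <= t -> 0 <= b <= t ->
    `|a *: u + b *: v| < r.
  move=> t0; rewrite ltr_pdivlMr// => tr /andP[a0 at_] /andP[b0 bt].
  apply: le_lt_trans tr; rewrite (le_trans (ler_normD _ _))// !normrZ.
  rewrite !ger0_norm// /K !mulrDr mulr1 mulrA.
  have := ler_wpM2r (normr_ge0 u) at_; have := ler_wpM2r (normr_ge0 v) bt.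
  have : 0 <= t * `|u| by rewrite mulr_ge0// ltW.
  lra.
near=> t.
have t0 : 0 < t by near: t; exact: nbhs_right_gt.
have tr : t < r / K by near: t; apply: nbhs_right_lt; rewrite divr_gt0.
have inball a b : 0 <= a <= t -> 0 <= b <= t -> ball (0 : V) r (a *: u + b *: v).
  by move=> a0 b0; rewrite -ball_normE/= sub0r normrN (small t).
pose psi s := h (x + t *: v + s *: u) - h (x + s *: u).
have dpsi s : 0 <= s <= t -> is_derive s 1 psi
    ('D_u h (x + t *: v + s *: u) - 'D_u h (x + s *: u)).
  move=> s0; apply: is_deriveB; apply: is_derive_line.
    have tt : 0 <= t <= t by rewrite lexx ltW.
    by have /rP[_] := inball _ _ s0 tt; rewrite -addrA [t *: v + _]addrC.
  have z0 : 0 <= (0 : R) <= t by rewrite lexx ltW.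
  by have /rP[_] := inball _ _ s0 z0; rewrite scale0r addr0.
have [s] : exists2 s, s \in `]0, t[ & psi t - psi 0 =
    ('D_u h (x + t *: v + s *: u) - 'D_u h (x + s *: u)) * (t - 0).
  apply: MVT => // [s|].
    by rewrite in_itv/= => /andP[s0 st]; apply: dpsi; rewrite !ltW.
  apply: derivable_within_continuous => s; rewrite in_itv/= => st.
  by have [] := dpsi _ st.
rewrite in_itv/= subr0 => /andP[s0 st] E.
have st' : 0 <= s <= t by rewrite !ltW.
have [/rP[+ _] /rP[+ _]] : ball (0 : V) r (s *: u + t *: v) /\
    ball (0 : V) r (s *: u + 0 *: v).
  by split; apply: inball; rewrite ?lexx ?ltW.
have dZ (k : R) w : 'd ('D_u h) x (k *: w) = k * 'd ('D_u h) x w by rewrite linearZ.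
rewrite scale0r addr0 linearD !dZ.
set a := 'D_u h (x + (s *: u + t *: v)); set b := 'D_u h (x + s *: u).
set c := 'D_u h x; set L := 'd _ x v; set M := 'd _ x u => A B.
have -> : h (x + t *: u + t *: v) - h (x + t *: u) - h (x + t *: v) + h x =
    (a - b) * t.
  rewrite /a /b addrA addrAC -E /psi scale0r !addr0 opprB addrAC.
  by rewrite [x + t *: v + t *: u]addrAC addrA addrAC.
have -> : (a - b) * t - t ^+ 2 * L =
    t * ((a - c - (s * M + t * L)) - (b - c - s * M)).
  by ring.
rewrite normrM (gtr0_norm t0) expr2 mulrCA ler_pM2l//.
apply: le_trans (ler_normB _ _) _; apply: le_trans (lerD A B) _.
rewrite -mulrDr mulrAC ler_pdivrMr// -mulrA ler_pM2l//.
have := ler_normD (s *: u) (t *: v); rewrite !normrZ (gtr0_norm s0) (gtr0_norm t0).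
have := ler_wpM2r (normr_ge0 u) (ltW st).
by rewrite /K !mulrDr mulr1; lra.
Unshelve. all: by end_near. Qed.

(** The second difference is symmetric in [u] and [v], and by the estimate its quotient by [t ^+ 2]
    tends to each of the two mixed derivatives. *)
Lemma derive_mixed h x u v :
  (\forall y \near x, derivable h y u) -> (\forall y \near x, derivable h y v) ->
  differentiable ('D_u h) x -> differentiable ('D_v h) x ->
  'D_v ('D_u h) x = 'D_u ('D_v h) x.
Proof.
move=> hu hv gu gv; rewrite !deriveE//.
apply/eqP; rewrite -subr_eq0 -normr_le0; apply/ler_addgt0Pl => e e0.
rewrite addr0.
have e2 : 0 < e / 2 by rewrite divr_gt0.
near (0 : R)^'+ => t.
have t0 : 0 < t by near: t; exact: nbhs_right_gt.
have : `|h (x + t *: u + t *: v) - h (x + t *: u) - h (x + t *: v) + h x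
      - t ^+ 2 * 'd ('D_u h) x v| <= e / 2 * t ^+ 2.
  by near: t; exact: second_difference_estimate.
have : `|h (x + t *: v + t *: u) - h (x + t *: v) - h (x + t *: u) + h x
      - t ^+ 2 * 'd ('D_v h) x u| <= e / 2 * t ^+ 2.
  by near: t; exact: second_difference_estimate.
rewrite [x + t *: v + t *: u]addrAC [h _ - h (x + t *: v) - _]addrAC.
set D := _ + h x => A B.
have t2 : 0 < t ^+ 2 by rewrite exprn_gt0.
rewrite -(ler_pM2l t2) -[X in X * _]gtr0_norm// -normrM mulrBr.
have -> : t ^+ 2 * 'd ('D_u h) x v - t ^+ 2 * 'd ('D_v h) x u =
  (D - t ^+ 2 * 'd ('D_v h) x u) - (D - t ^+ 2 * 'd ('D_u h) x v) by ring.
apply: le_trans (ler_normB _ _) _; apply: le_trans (lerD A B) _.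
by rewrite -mulrDl -splitr mulrC.
Unshelve. all: by end_near. Qed.

End MixedPartials.

(** * Partial derivatives and normal jets *)

Section Partials.
Context {R : realType}.
Implicit Types (f g : R * R -> R) (U : set (R * R)).

(** The order of differentiation is that of [taylor_part], so the Taylor hypothesis of a normal form
    is a statement about [pd f i j (0, 0)] by conversion. *)
Definition pd f i j : R * R -> R :=
  iter i (fun g => 'D_((1, 0) : R * R) g)
    (iter j (fun g => 'D_((0, 1) : R * R) g) f).

Arguments pd : simpl never.

Lemma pd00E f : pd f 0 0 = f. Proof. by []. Qed.

Definition smooth_in U f := forall k, C_k k U f.

Lemma smooth_in_derive U f v : smooth_in U f -> smooth_in U ('D_v f).
Proof. by move=> fU k; have [_ H] := fU k.+1; exact: H. Qed.

Lemma smooth_in_differentiable U f s :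
  smooth_in U f -> U s -> differentiable f s.
Proof. by move=> fU Us; have [+ _] := fU 1%N; apply. Qed.

Lemma smooth_in_pd U f i j : smooth_in U f -> smooth_in U (pd f i j).
Proof.
move=> fU; rewrite /pd; elim: i => [|i IHi] /=.
  by elim: j => [//|j IHj] /=; exact: smooth_in_derive.
exact: smooth_in_derive.
Qed.

(** The new derivative in the second direction has to pass the [i] derivatives in the first one;
    each step of the induction is one use of [derive_mixed]. *)
Lemma derive_pd U f i j s : open U -> smooth_in U f -> U s ->
  'D_((0, 1) : R * R) (pd f i j) s = pd f i j.+1 s.
Proof.
move=> Uo fU; elim: i s => [//|i IHi] s Us.
have Us' : \forall y \near s, U y by exact: open_nbhs_nbhs.
have dU k l v : \forall y \near s, derivable (pd f k l) y v.
  apply: filterS Us' => y Uy; apply: diff_derivable.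
  exact: smooth_in_differentiable (smooth_in_pd _ _ fU) Uy.
have ddU k l v : differentiable ('D_v (pd f k l)) s.
  apply: smooth_in_differentiable Us.
  exact/smooth_in_derive/smooth_in_pd.
rewrite [LHS](derive_mixed (h := pd f i j)) //.
by apply: near_eq_derive; apply: filterS Us'.
Qed.

Lemma is_diff_pd U f i j s : open U -> smooth_in U f -> U s ->
  is_diff s (pd f i j)
    (fun h => h.1 * pd f i.+1 j s + h.2 * pd f i j.+1 s).
Proof.
move=> Uo fU Us.
have df := smooth_in_differentiable (smooth_in_pd i j fU) Us.
apply: is_diff_ext (differentiableP df) _ => h.
have hE : h = h.1 *: ((1, 0) : R * R) + h.2 *: ((0, 1) : R * R).
  by case: h => a b; congr (_, _); rewrite /= -![_ *: _]/(_ * _)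
    !(mulr0, mulr1, addr0, add0r).
rewrite -(derive_pd i j Uo fU Us).
rewrite -[pd f i.+1 j s]/('D_((1, 0) : R * R) (pd f i j) s).
rewrite [X in 'd _ _ X = _]hE linearD; congr (_ + _); rewrite linearZ deriveE//.
Qed.

Lemma pd_near f g (s : R * R) i j : (\forall y \near s, f y = g y) ->
  \forall y \near s, pd f i j y = pd g i j y.
Proof.
have D (h k : R * R -> R) (v : R * R) : (\forall y \near s, h y = k y) ->
    \forall y \near s, 'D_v h y = 'D_v k y.
  by move=> /near_join; apply: filterS => y; exact: near_eq_derive.
move=> fg; rewrite /pd; elim: i => [|i IHi] /=; last exact: D.
by elim: j => [//|j IHj] /=; exact: D.
Qed.

(** The entries are derivatives, that is, Taylor coefficients times factorials: the term
    [- 3 x y ^+ 2 / 6] gives [-1] for [p 1 2]. *)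
Record normal_jet (p I : nat -> nat -> R) : Prop := NormalJet {
  jet00 : p 0%N 0%N = 0;
  jet10 : p 1%N 0%N = 0;
  jet01 : p 0%N 1%N = 0;
  jet20 : p 2%N 0%N = 1;
  jet11 : p 1%N 1%N = 0;
  jet02 : p 0%N 2%N = 1;
  jet30 : p 3%N 0%N = 1;
  jet21 : p 2%N 1%N = 0;
  jet12 : p 1%N 2%N = -1;
  jet03 : p 0%N 3%N = 0;
  jet40 : p 4%N 0%N = I 4%N 0%N;
  jet31 : p 3%N 1%N = I 3%N 1%N;
  jet22 : p 2%N 2%N = I 2%N 2%N;
  jet13 : p 1%N 3%N = I 1%N 3%N;
  jet04 : p 0%N 4%N = I 0%N 4%N }.

Lemma normal_part_jet (p I : nat -> nat -> R) :
  (forall n x y, \sum_(i < n.+1)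
      p i (n - i)%N / (i`! * (n - i)`!)%:R * x ^+ i * y ^+ (n - i) =
    normal_part I n x y) ->
  normal_jet p I.
Proof.
move=> pI.
have f1 : (1`! = 1)%N by []. have f2 : (2`! = 2)%N by [].
have f3 : (3`! = 6)%N by []. have f4 : (4`! = 24)%N by [].
have H0 : p 0%N 0%N = 0.
  have := pI 0%N 0 0; rewrite /normal_part !big_ord_recr big_ord0 /=.
  by rewrite fact0 !expr0 !mulr1 divr1 add0r.
have H1 x y : p 0%N 1%N * y + p 1%N 0%N * x = 0.
  rewrite -[RHS](pI 1%N x y) !big_ord_recr big_ord0 /= subn0 subnn f1 fact0.
  by field.
have H2 x y : p 0%N 2%N / 2 * y ^+ 2 + p 1%N 1%N * x * y
    + p 2%N 0%N / 2 * x ^+ 2 = 2^-1 * (x ^+ 2 + y ^+ 2).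
  rewrite -[RHS](pI 2%N x y) !big_ord_recr big_ord0 /= subn0 subnn ?f1 ?f2 fact0.
  rewrite (_ : 2 - 1 = 1)%N// ?f1; by field.
have H3 x y : p 0%N 3%N / 6 * y ^+ 3 + p 1%N 2%N / 2 * x * y ^+ 2
    + p 2%N 1%N / 2 * x ^+ 2 * y + p 3%N 0%N / 6 * x ^+ 3
    = 6^-1 * (x ^+ 3 - 3 * x * y ^+ 2).
  rewrite -[RHS](pI 3%N x y) !big_ord_recr big_ord0 /= subn0 subnn.
  rewrite (_ : 3 - 1 = 2)%N// (_ : 3 - 2 = 1)%N// ?f1 ?f2 ?f3 fact0. by field.
have H4 x y : p 0%N 4%N * y ^+ 4 + 4 * p 1%N 3%N * x * y ^+ 3
    + 6 * p 2%N 2%N * x ^+ 2 * y ^+ 2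
    + 4 * p 3%N 1%N * x ^+ 3 * y + p 4%N 0%N * x ^+ 4
    = I 0%N 4%N * y ^+ 4 + 4 * I 1%N 3%N * x * y ^+ 3
    + 6 * I 2%N 2%N * x ^+ 2 * y ^+ 2
    + 4 * I 3%N 1%N * x ^+ 3 * y + I 4%N 0%N * x ^+ 4.
  have := pI 4%N x y; rewrite /normal_part !big_ord_recr !big_ord0 /= subn0 subnn.
  rewrite (_ : 4 - 1 = 3)%N// (_ : 4 - 2 = 2)%N// (_ : 4 - 3 = 1)%N//.
  rewrite ?f1 ?f2 ?f3 ?f4 fact0.
  rewrite bin0 bin1 binn (_ : 'C(4, 2) = 6)%N// (_ : 'C(4, 3) = 4)%N//.
  move=> H; have {}H := congr1 ( *%R 24) H.
  by apply: etrans (etrans H _); field.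
(* A binary form of degree [n] is determined by its values at [n + 1] pairwise non-proportional
   points. *)
have [A1 B1] := (H1 1 0, H1 0 1); have [A2 B2] := (H2 1 0, H2 0 1).
have C2 := H2 1 1; have [A3 B3] := (H3 1 0, H3 0 1).
have [C3 D3] := (H3 1 1, H3 1 (-1)).
have [A4 B4] := (H4 1 0, H4 0 1); have [C4 D4] := (H4 1 1, H4 1 (-1)).
have E4 := H4 1 2.
by split; lra.
Qed.

Lemma taylor_normal_jet f I :
  (forall n x y, taylor_part f n x y = normal_part I n x y) ->
  normal_jet (fun i j => pd f i j (0, 0)) I.
Proof. by move=> fI; apply: normal_part_jet => n x y; rewrite -fI. Qed.

End Partials.

(* [ring] and [lra] compare atoms up to conversion and would unfold [pd]. *)
Opaque pd.

(** * Third-order contact of a curve with a graph *)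

Section CurvesOnGraphs.
Context {R : realType}.

Lemma is_derive_add_fun (f g : R -> R) df dg (t : R) :
  is_derive t 1 f df -> is_derive t 1 g dg ->
  is_derive t 1 (fun s => f s + g s) (df + dg).
Proof. exact: is_deriveD. Qed.

Lemma is_derive_mul_fun (f g : R -> R) df dg (t : R) :
  is_derive t 1 f df -> is_derive t 1 g dg ->
  is_derive t 1 (fun s => f s * g s) (df * g t + f t * dg).
Proof.
move=> ft gt; apply: is_derive_eq (is_deriveM ft gt) _.
by rewrite -![_ *: _]/(_ * _) addrC [df * _]mulrC.
Qed.

Lemma is_derive_cst_fun (a t : R) : is_derive t 1 (fun=> a) (0 : R).
Proof. exact: is_derive_cst. Qed.

Lemma is_derive_id_fun (t : R) : is_derive t 1 (fun s : R => s) (1 : R).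
Proof. exact: is_derive_id. Qed.

(** The conclusion again holds near [a], so an identity can be differentiated repeatedly. *)
Lemma derive_near_unique (f g df dg : R -> R) (a : R) :
  (\forall t \near a, f t = g t) ->
  (\forall t \near a, is_derive (t : R) (1 : R) f (df t)) ->
  (\forall t \near a, is_derive (t : R) (1 : R) g (dg t)) ->
  \forall t \near a, df t = dg t.
Proof.
move=> /near_join fg f' g'; near=> t.
have ft : is_derive t 1 f (df t) by near: t.
have gt : is_derive t 1 g (dg t) by near: t.
rewrite -(@derive_val _ _ _ _ _ _ _ ft) -(@derive_val _ _ _ _ _ _ _ gt).
by apply: near_eq_derive; near: t.
Unshelve. all: by end_near. Qed.

Lemma is_derive_pd_curve (U : set (R * R)) f i j (x y : R -> R) dx dy (t : R) :
  open U -> smooth_in U f -> U (x t, y t) ->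
  is_derive t 1 x dx -> is_derive t 1 y dy ->
  is_derive t 1 (fun s => pd f i j (x s, y s))
    (dx * pd f i.+1 j (x t, y t) + dy * pd f i j.+1 (x t, y t)).
Proof.
move=> Uo fU Ut /is_derive_is_diff xt /is_derive_is_diff yt.
have c : is_derive t 1 (fun s => (x s, y s)) (dx, dy).
  by apply/is_derive_is_diff; apply: is_diff_pair.
exact: (is_derive_comp_curve (is_diff_pd i j Uo fU Ut) c).
Qed.

(* The curve [t |-> q + t v + h(t) n], where [h(t) = g(t v)] and [g] has the
   3-jet of a normal form, lies on the graph of [f]: compare derivatives up to
   order 3 at [t = 0]. *)
Lemma graph_curve_jet (U U' : set (R * R)) (f g : R * R -> R) I
    (v1 v2 x0 y0 z0 x1 y1 z1 x2 y2 z2 : R) :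
  open U -> smooth_in U f -> U (x0, y0) ->
  open U' -> smooth_in U' g -> U' (0, 0) ->
  normal_jet (fun i j => pd g i j (0, 0)) I ->
  (\forall t \near (0 : R), z0 + t * z1 + g (t * v1, t * v2) * z2 =
     f (x0 + t * x1 + g (t * v1, t * v2) * x2,
        y0 + t * y1 + g (t * v1, t * v2) * y2)) ->
  let p i j := pd f i j (x0, y0) in
  let m := v1 ^+ 2 + v2 ^+ 2 in
  let k := v1 ^+ 3 - 3 * v1 * v2 ^+ 2 in
  [/\ z1 = x1 * p 1%N 0%N + y1 * p 0%N 1%N,
      m * z2 = x1 ^+ 2 * p 2%N 0%N + 2 * x1 * y1 * p 1%N 1%N
        + y1 ^+ 2 * p 0%N 2%N + m * (x2 * p 1%N 0%N + y2 * p 0%N 1%N) &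
      k * z2 = x1 ^+ 3 * p 3%N 0%N + 3 * x1 ^+ 2 * y1 * p 2%N 1%N
        + 3 * x1 * y1 ^+ 2 * p 1%N 2%N + y1 ^+ 3 * p 0%N 3%N
        + 3 * m * (x1 * x2 * p 2%N 0%N + (x1 * y2 + x2 * y1) * p 1%N 1%N
                   + y1 * y2 * p 0%N 2%N)
        + k * (x2 * p 1%N 0%N + y2 * p 0%N 1%N)].
Proof.
move=> Uo fU U0 Uo' gU' U0' gI H p m k.
pose G i j t := pd g i j (t * v1, t * v2).
(* [h0] is [g (t v)] and [h1], [h2], [h3] are its successive derivatives; at [t = 0] the normal
   3-jet gives them the values [0], [0], [m], [k]. *)
pose h0 := G 0%N 0%N.
pose h1 t := v1 * G 1%N 0%N t + v2 * G 0%N 1%N t.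
pose h2 t := v1 * (v1 * G 2%N 0%N t + v2 * G 1%N 1%N t)
  + v2 * (v1 * G 1%N 1%N t + v2 * G 0%N 2%N t).
pose h3 t := v1 * (v1 * (v1 * G 3%N 0%N t + v2 * G 2%N 1%N t)
    + v2 * (v1 * G 2%N 1%N t + v2 * G 1%N 2%N t))
  + v2 * (v1 * (v1 * G 2%N 1%N t + v2 * G 1%N 2%N t)
    + v2 * (v1 * G 1%N 2%N t + v2 * G 0%N 3%N t)).
have dmul a (t : R) : is_derive t 1 (fun s => s * a) a.
  by apply: is_derive_eq
    (is_derive_mul_fun (is_derive_id_fun t) (is_derive_cst_fun a t)) _; ring.
have U'near : \forall t \near (0 : R), U' (t * v1, t * v2).
  have [dv _] := is_diff_pair
    ((is_derive_is_diff _ _ _).1 (dmul v1 0)) ((is_derive_is_diff _ _ _).1 (dmul v2 0)).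
  apply: (differentiable_continuous dv); rewrite !mul0r.
  exact: open_nbhs_nbhs.
have dG i j t : U' (t * v1, t * v2) ->
    is_derive t 1 (G i j) (v1 * G i.+1 j t + v2 * G i j.+1 t).
  move=> Ut; exact: (@is_derive_pd_curve U' g i j (fun s => s * v1)
    (fun s => s * v2) v1 v2 t Uo' gU' Ut (dmul v1 t) (dmul v2 t)).
have daff (a b c : R) (h : R -> R) dh (t : R) : is_derive t 1 h dh ->
    is_derive t 1 (fun s => a + s * b + h s * c) (b + dh * c).
  by move=> ht; apply: is_derive_eq (is_derive_add_fun
    (is_derive_add_fun (is_derive_cst_fun a t) (dmul b t))
    (is_derive_mul_fun ht (is_derive_cst_fun c t))) _; ring.
have dcomb (a b : R) (h l : R -> R) dh dl (t : R) : is_derive t 1 h dh ->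
    is_derive t 1 l dl -> is_derive t 1 (fun s => a * h s + b * l s) (a * dh + b * dl).
  by move=> ht lt'; apply: is_derive_eq (is_derive_add_fun
    (is_derive_mul_fun (is_derive_cst_fun a t) ht)
    (is_derive_mul_fun (is_derive_cst_fun b t) lt')) _; ring.
have d0 t : U' (t * v1, t * v2) -> is_derive t 1 h0 (h1 t) by exact: dG.
have d1 t : U' (t * v1, t * v2) -> is_derive t 1 h1 (h2 t).
  by move=> Ut; apply: (dcomb); exact: dG.
have d2 t : U' (t * v1, t * v2) -> is_derive t 1 h2 (h3 t).
  by move=> Ut; apply: (dcomb); apply: (dcomb); exact: dG.
have G0 i j : G i j 0 = pd g i j (0, 0) by rewrite /G !mul0r.
have h00 : h0 0 = 0 by rewrite /h0 G0; exact: jet00 gI.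
have h10 : h1 0 = 0 by rewrite /h1 !G0 (jet10 gI) (jet01 gI) !mulr0 addr0.
have h20 : h2 0 = m.
  by rewrite /h2 !G0 (jet20 gI) (jet11 gI) (jet02 gI) /m; ring.
have h30 : h3 0 = k.
  by rewrite /h3 !G0 (jet30 gI) (jet21 gI) (jet12 gI) (jet03 gI) /k; ring.
have {H} : \forall t \near (0 : R), z0 + t * z1 + h0 t * z2 =
    pd f 0 0 (x0 + t * x1 + h0 t * x2, y0 + t * y1 + h0 t * y2).
  by rewrite /h0 /G !pd00E.
clearbody h0 h1 h2 h3; clear dG dcomb G0 gI G.
pose X t := x0 + t * x1 + h0 t * x2; pose Y t := y0 + t * y1 + h0 t * y2.
pose X1 t := x1 + h1 t * x2; pose Y1 t := y1 + h1 t * y2.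
pose F i j t := pd f i j (X t, Y t) => E0.
have dX a b c t : U' (t * v1, t * v2) ->
    is_derive t 1 (fun s => a + s * b + h0 s * c) (b + h1 t * c).
  by move=> Ut; exact: (daff a b c _ _ _ (d0 t Ut)).
have dh (h dh : R -> R) b c (t : R) : is_derive t 1 h (dh t) ->
    is_derive t 1 (fun s => b + h s * c) (dh t * c).
  by move=> ht; apply: is_derive_eq (is_derive_add_fun (is_derive_cst_fun b t)
   (is_derive_mul_fun ht (is_derive_cst_fun c t))) _; ring.
have X0 : X 0 = x0 by rewrite /X h00; ring.
have Y0 : Y 0 = y0 by rewrite /Y h00; ring.
have Unear : \forall t \near (0 : R), U' (t * v1, t * v2) /\ U (X t, Y t).
  have U'0 := nbhs_singleton U'near.
  have [dv _] := is_diff_pair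
    ((is_derive_is_diff _ _ _).1 (dX x0 x1 x2 0 U'0))
    ((is_derive_is_diff _ _ _).1 (dX y0 y1 y2 0 U'0)).
  apply: filterS2 U'near _ => [t Ut Xt|]; first by split; [exact: Ut|exact: Xt].
  apply: (differentiable_continuous dv); rewrite -/(X 0) -/(Y 0) X0 Y0.
  exact: open_nbhs_nbhs.
have dF i j t : U' (t * v1, t * v2) /\ U (X t, Y t) ->
    is_derive t 1 (F i j) (X1 t * F i.+1 j t + Y1 t * F i j.+1 t).
  move=> [Ut Vt].
  exact: (is_derive_pd_curve i j Uo fU Vt (dX _ _ _ _ Ut) (dX _ _ _ _ Ut)).
have dX1 t b c : U' (t * v1, t * v2) ->
    is_derive t 1 (fun s => b + h1 s * c) (h2 t * c).
  by move=> Ut; apply: (dh); exact: d1.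
have dX2 t c : U' (t * v1, t * v2) -> is_derive t 1 (fun s => h2 s * c) (h3 t * c).
  move=> Ut; apply: is_derive_eq
    (is_derive_mul_fun (d2 t Ut) (is_derive_cst_fun c t)) _; ring.
(* [E1], [E2], [E3] are the derivatives of [E0], left exactly as the sum and product rules produce
   them, so that each can be differentiated by syntax alone. *)
have E1 : \forall t \near (0 : R),
    z1 + h1 t * z2 = X1 t * F 1%N 0%N t + Y1 t * F 0%N 1%N t.
  apply: derive_near_unique E0 _ _; apply: filterS Unear => t Ut.
    by apply: dX; case: Ut.
  exact: dF.
have E2 : \forall t \near (0 : R), h2 t * z2 =
    (h2 t * x2 * F 1%N 0%N t
       + X1 t * (X1 t * F 2%N 0%N t + Y1 t * F 1%N 1%N t))
    + (h2 t * y2 * F 0%N 1%N t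
       + Y1 t * (X1 t * F 1%N 1%N t + Y1 t * F 0%N 2%N t)).
  apply: derive_near_unique E1 _ _; apply: filterS Unear => t Ut.
    by apply: dX1; case: Ut.
  apply: is_derive_add_fun; apply: is_derive_mul_fun; try exact: dF.
    by apply: dX1; case: Ut.
  by apply: dX1; case: Ut.
have E3 : \forall t \near (0 : R), h3 t * z2 =
    ((h3 t * x2 * F 1%N 0%N t
       + h2 t * x2 * (X1 t * F 2%N 0%N t + Y1 t * F 1%N 1%N t))
     + (h2 t * x2 * (X1 t * F 2%N 0%N t + Y1 t * F 1%N 1%N t)
       + X1 t * ((h2 t * x2 * F 2%N 0%N t
                  + X1 t * (X1 t * F 3%N 0%N t + Y1 t * F 2%N 1%N t))
                + (h2 t * y2 * F 1%N 1%N t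
                  + Y1 t * (X1 t * F 2%N 1%N t + Y1 t * F 1%N 2%N t)))))
    + ((h3 t * y2 * F 0%N 1%N t
       + h2 t * y2 * (X1 t * F 1%N 1%N t + Y1 t * F 0%N 2%N t))
     + (h2 t * y2 * (X1 t * F 1%N 1%N t + Y1 t * F 0%N 2%N t)
       + Y1 t * ((h2 t * x2 * F 1%N 1%N t
                  + X1 t * (X1 t * F 2%N 1%N t + Y1 t * F 1%N 2%N t))
                + (h2 t * y2 * F 0%N 2%N t
                  + Y1 t * (X1 t * F 1%N 2%N t + Y1 t * F 0%N 3%N t))))).
  apply: derive_near_unique E2 _ _; apply: filterS Unear => t Ut.
    by apply: dX2; case: Ut.
  have [Ut' _] := Ut; do ?[exact: dF | exact: dX1 | exact: dX2
    | apply: is_derive_add_fun | apply: is_derive_mul_fun].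
move: (nbhs_singleton E1) (nbhs_singleton E2) (nbhs_singleton E3).
have F0 i j : F i j 0 = p i j by rewrite /F X0 Y0.
rewrite !F0 /X1 /Y1 h10 h20 h30 !mul0r !addr0.
clear; clearbody p m k => -> -> ->.
by split; ring.
Qed.

End CurvesOnGraphs.

(** * Composition of smooth maps with affine maps *)

Section SmoothMaps.
Context {R : realType}.
Implicit Types V W X : normedModType R.

(** [C_k] recurses on the total function ['D_v f], whose closed form is known on [U] only; as [U] is
    open, derivatives there see nothing else. *)
Lemma C_k_eq V W k (U : set V) (f g : V -> W) : open U ->
  (forall x, U x -> f x = g x) -> C_k k U f -> C_k k U g.
Proof.
move=> Uo; elim: k f g => [|k IHk] f g fg /=.
  move=> fU x Ux; have fgx : \forall y \near x, f y = g y.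
    by apply: filterS fg _; exact: open_nbhs_nbhs.
  change (g @ x --> g x); rewrite -(fg x Ux); apply: cvg_trans (fU x Ux).
  by apply: near_eq_cvg; apply: filterS fgx => y ->.
have fgx x : U x -> \forall y \near x, f y = g y.
  by move=> Ux; apply: filterS fg _; exact: open_nbhs_nbhs.
move=> [df Df]; split=> [x Ux|v].
  by have [] := is_diff_eq_near (fgx x Ux) (differentiableP (df x Ux)).
by apply: IHk (Df v) => x Ux; exact: near_eq_derive (fgx x Ux).
Qed.

Lemma C_k_cst V W k (U : set V) (a : W) : C_k k U (cst a).
Proof.
elim: k a => [|k IHk] a /=; first by move=> x _; exact: cvg_cst.
split=> [x _|v]; first exact: differentiable_cst.
by rewrite (_ : 'D_v (cst a) = cst 0)//; apply/funext => x; rewrite derive_cst.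
Qed.

Lemma is_diff_derive V W (f : V -> W) df x v :
  is_diff x f df -> 'D_v f x = df v.
Proof. by move=> [fx <-]; rewrite deriveE. Qed.

Lemma C_k_affine V W k (U : set V) (l dl : V -> W) :
  (forall x, is_diff x l dl) -> C_k k U l.
Proof.
move=> lx; case: k => [|k] /=.
  by move=> x _; apply: differentiable_continuous; have [] := lx x.
split=> [x _|v]; first by have [] := lx x.
rewrite (_ : 'D_v l = cst (dl v)); first exact: C_k_cst.
by apply/funext => x; rewrite (is_diff_derive _ (lx x)).
Qed.

Lemma C_k_add V W k (U : set V) (f g : V -> W) : open U ->
  C_k k U f -> C_k k U g -> C_k k U (fun x => f x + g x).
Proof.
move=> Uo; elim: k f g => [|k IHk] f g /=.
  by move=> fU gU x Ux; apply: continuousD; [exact: fU|exact: gU].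
move=> [df Df] [dg Dg]; split=> [x Ux|v].
  by apply: differentiableD; [exact: df|exact: dg].
apply: C_k_eq (IHk _ _ (Df v) (Dg v)) => // x Ux.
by rewrite [RHS]deriveD//; apply: diff_derivable; [exact: df|exact: dg].
Qed.

(** [dl] does not depend on the point, so the derivative of the composite in the direction [v] is
    ['D_(dl v) f] composed with the same [l], and the induction closes. *)
Lemma C_k_comp_affine V W X k (U : set W) (f : W -> X) (l dl : V -> W) :
  open U -> (forall x, is_diff x l dl) -> C_k k U f ->
  C_k k (l @^-1` U) (fun x => f (l x)).
Proof.
move=> Uo lx.
have lc x : {for x, continuous l}.
  by apply: differentiable_continuous; have [] := lx x.
have Vo : open (l @^-1` U) by apply: open_comp => // x _; exact: lc.
elim: k f => [|k IHk] f /=.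
  by move=> fU x Ux; apply: continuous_comp; [exact: lc|exact: fU].
move=> [df Df]; split=> [x Ux|v].
  by apply: differentiable_comp; [have [] := lx x|exact: df].
apply: C_k_eq (IHk _ (Df (dl v))) => // x Ux.
have := is_diff_comp_fun (lx x) (differentiableP (df _ Ux)).
by move=> /(is_diff_derive v) ->; rewrite deriveE//; exact: df.
Qed.

(** That [dg] is its own differential at every point expresses its linearity; after one derivative
    [g] is replaced by [dg], which then reproduces itself. *)
Lemma C_k_linear_comp V W X k (U : set V) (f : V -> W) (g dg : W -> X) :
  open U -> (forall y, is_diff y g dg) -> (forall y, is_diff y dg dg) ->
  C_k k U f -> C_k k U (fun x => g (f x)).
Proof.
move=> Uo gy dgy; elim: k f g gy => [|k IHk] f g gy /=.
  move=> fU x Ux; apply: continuous_comp; first exact: fU.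
  by apply: differentiable_continuous; have [] := gy (f x).
move=> [df Df]; split=> [x Ux|v].
  by apply: differentiable_comp; [exact: df|have [] := gy (f x)].
apply: C_k_eq (IHk _ dg dgy (Df v)) => // x Ux.
have := is_diff_comp_fun (differentiableP (df _ Ux)) (gy (f x)).
by move=> /(is_diff_derive v) ->; rewrite deriveE//; exact: df.
Qed.

Lemma smooth_at_affine V W (x : V) (l dl : V -> W) :
  (forall x, is_diff x l dl) -> smooth_at x l.
Proof. by move=> lx; exists setT => [|k]; [exact: open_nbhsT|exact: C_k_affine]. Qed.

Lemma smooth_at_comp_affine V W X (x : V) (f : W -> X) (l dl : V -> W) :
  (forall x, is_diff x l dl) -> smooth_at (l x) f ->
  smooth_at x (fun y => f (l y)).
Proof.
move=> lx [U [Uo Ux] fU]; exists (l @^-1` U).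
  split => //; apply: open_comp => // y _.
  by apply: differentiable_continuous; have [] := lx y.
by move=> k; exact: C_k_comp_affine.
Qed.

Lemma smooth_at_linear_comp V W X (x : V) (f : V -> W) (g dg : W -> X) :
  (forall y, is_diff y g dg) -> (forall y, is_diff y dg dg) ->
  smooth_at x f -> smooth_at x (fun y => g (f y)).
Proof.
move=> gy dgy [U [Uo Ux] fU]; exists U => // k.
exact: C_k_linear_comp.
Qed.

Lemma smooth_at_add V W (x : V) (f g : V -> W) :
  smooth_at x f -> smooth_at x g -> smooth_at x (fun y => f y + g y).
Proof.
move=> [U [Uo Ux] fU] [U' [Uo' Ux'] gU]; exists (U `&` U').
  by split; [exact: openI|].
have C_k_sub k h (A B : set V) : B `<=` A -> C_k k A h -> C_k k B (h : V -> W).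
  move=> BA; elim: k h => [|k IHk] h /=; first by move=> hA y /BA; exact: hA.
  by move=> [dh Dh]; split=> [y /BA|v]; [exact: dh|exact: IHk].
move=> k; apply: C_k_add; first exact: openI.
  by apply: C_k_sub (fU k) => y [].
by apply: C_k_sub (gU k) => y [].
Qed.

Lemma smooth_at_differentiable V W (x : V) (f : V -> W) :
  smooth_at x f -> \forall y \near x, differentiable f y.
Proof.
move=> [U [Uo Ux] fU]; have [dU _] := fU 1%N.
by apply: filterS dU _; exact: open_nbhs_nbhs.
Qed.

End SmoothMaps.

(** * Graph charts and tangent vectors *)

Section GraphCharts.
Context {R : realType}.
Implicit Types (V : normedModType R) (S : set 'rV[R]_3) (P Q : 'rV[R]_3)
  (E : 'M[R]_3) (I : nat -> nat -> R).

Lemma I3P (Q : 'I_3 -> Prop) : Q 0 -> Q 1 -> Q 2 -> forall i, Q i.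
Proof.
move=> Q0 Q1 Q2 [[|[|[|//]]] lti].
- by rewrite (_ : Ordinal lti = 0)//; apply/val_inj.
- by rewrite (_ : Ordinal lti = 1)//; apply/val_inj.
- by rewrite (_ : Ordinal lti = 2)//; apply/val_inj.
Qed.

Lemma sum3 (F : 'I_3 -> R) : \sum_i F i = F 0 + F 1 + F 2.
Proof.
rewrite !big_ord_recr big_ord0 /= add0r.
by congr (F _ + F _ + F _); apply/val_inj.
Qed.

Lemma mulmx3 m n (A : 'M[R]_(m, 3)) (B : 'M[R]_(3, n)) i j :
  (A *m B) i j = A i 0 * B 0 j + A i 1 * B 1 j + A i 2 * B 2 j.
Proof. by rewrite mxE sum3. Qed.

Definition vec3 (x y z : R) : 'rV[R]_3 := \row_j nth 0 [:: x; y; z] j.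

Lemma vec30 x y z : vec3 x y z 0 0 = x. Proof. by rewrite mxE. Qed.
Lemma vec31 x y z : vec3 x y z 0 1 = y. Proof. by rewrite mxE. Qed.
Lemma vec32 x y z : vec3 x y z 0 2 = z. Proof. by rewrite mxE. Qed.
Definition vec3E := (vec30, vec31, vec32).

Lemma vec3_eta (q : 'rV[R]_3) : q = vec3 (q 0 0) (q 0 1) (q 0 2).
Proof. by apply/rowP; apply: I3P; rewrite vec3E. Qed.

Lemma vec3_mul x y z E :
  vec3 x y z *m E = x *: row 0 E + y *: row 1 E + z *: row 2 E.
Proof. by apply/rowP => j; rewrite mulmx3 !vec3E !mxE. Qed.

Lemma is_diff_vec3 V (a b c da db dc : V -> R) x :
  is_diff x a da -> is_diff x b db -> is_diff x c dc ->
  is_diff x (fun y => vec3 (a y) (b y) (c y))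
    (fun h => vec3 (da h) (db h) (dc h)).
Proof.
move=> ax bx cx; apply/is_diff_mxP => i; rewrite (ord1 i); apply: I3P.
- under eq_fun do rewrite vec3E.
  by under [X in is_diff _ _ X]eq_fun do rewrite vec3E.
- under eq_fun do rewrite vec3E.
  by under [X in is_diff _ _ X]eq_fun do rewrite vec3E.
- under eq_fun do rewrite vec3E.
  by under [X in is_diff _ _ X]eq_fun do rewrite vec3E.
Qed.

Lemma is_diff_mulmxr V m n p (A dA : V -> 'M[R]_(m, n)) (B : 'M[R]_(n, p)) x :
  is_diff x A dA -> is_diff x (fun y => A y *m B) (fun h => dA h *m B).
Proof.
move=> Ax; apply: is_diff_ext (is_diff_mulmx Ax (is_diff_cst B x)) _ => h.
have z0 : (0 : V -> 'M[R]_(n, p)) h = 0 by [].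
by rewrite z0 mulmx0 addr0.
Qed.

Lemma is_diff_addl V (W : normedModType R) (a : W) (f df : V -> W) x :
  is_diff x f df -> is_diff x (fun y => a + f y) df.
Proof.
move=> fx; have := is_diffD (is_diff_cst a x) fx.
by rewrite add0r.
Qed.

Lemma is_diff_subr V (W : normedModType R) (a : W) (f df : V -> W) x :
  is_diff x f df -> is_diff x (fun y => f y - a) df.
Proof.
move=> fx; have := is_diffB fx (is_diff_cst a x).
by rewrite subr0.
Qed.

Lemma is_diff_continuous V (W : normedModType R) (f df : V -> W) x :
  is_diff x f df -> {for x, continuous f}.
Proof. by move=> [fx _]; exact: differentiable_continuous. Qed.

Lemma is_diff_fst (s : R * R) : is_diff s (fst : R * R -> R) fst.
Proof.
have c : continuous (fst : R * R -> R) by move=> x; exact: cvg_fst.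
by apply: DiffDef; [exact: linear_differentiable|exact: diff_lin].
Qed.

Lemma is_diff_snd (s : R * R) : is_diff s (snd : R * R -> R) snd.
Proof.
have c : continuous (snd : R * R -> R) by move=> x; exact: cvg_snd.
by apply: DiffDef; [exact: linear_differentiable|exact: diff_lin].
Qed.

Definition graph_point P E (f : R * R -> R) (s : R * R) :=
  P + vec3 s.1 s.2 (f s) *m E.

Lemma is_diff_graph_point P E f df s : is_diff s f df ->
  is_diff s (graph_point P E f) (fun h => vec3 h.1 h.2 (df h) *m E).
Proof.
move=> fs; apply/is_diff_addl/is_diff_mulmxr/is_diff_vec3 => //.
  exact: is_diff_fst.
exact: is_diff_snd.
Qed.

End GraphCharts.

Section Charts.
Context {R : realType}.
Implicit Types (V : normedModType R) (S : set 'rV[R]_3) (P Q v : 'rV[R]_3)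
  (E : 'M[R]_3) (I : nat -> nat -> R) (f : R * R -> R) (U : set (R * R)).

Lemma near_is_diff V (W : normedModType R) (f df : V -> W) x (X : W -> Prop) :
  is_diff x f df -> (\forall y \near f x, X y) -> \forall z \near x, X (f z).
Proof. by move=> /is_diff_continuous fx Xf; exact: fx. Qed.

(** [normal_form] with its witnesses exposed, and with the Taylor expansion cut down to the
    derivatives of order at most 4. *)
Record graph_chart S P E I f U : Prop := GraphChart {
  chart_unit : E \in unitmx;
  chart_open : open U;
  chart_origin : U (0, 0);
  chart_smooth : smooth_in U f;
  chart_jet : normal_jet (fun i j => pd f i j (0, 0)) I;
  chart_graph : is_graph_near S P E f }.

Lemma normal_form_chart S P E I :
  normal_form S P E I -> exists f U, graph_chart S P E I f U.
Proof.
move=> [Eu [f [[U [Uo U0] fU] fS fI]]]; exists f, U; split => //.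
exact: taylor_normal_jet.
Qed.

Section Chart.
Variables (S : set 'rV[R]_3) (P : 'rV[R]_3) (E : 'M[R]_3)
  (I : nat -> nat -> R) (f : R * R -> R) (U : set (R * R)).
Hypothesis ch : graph_chart S P E I f U.

Definition chart_coord Q : R * R :=
  (((Q - P) *m invmx E) 0 0, ((Q - P) *m invmx E) 0 1).

Lemma chart_value0 : f (0, 0) = 0.
Proof. by rewrite -[f](pd00E); exact: jet00 (chart_jet ch). Qed.

Lemma is_diff_chart s : U s ->
  is_diff s f (fun h => h.1 * pd f 1 0 s + h.2 * pd f 0 1 s).
Proof.
exact: (is_diff_pd 0 0 (chart_open ch) (chart_smooth ch)).
Qed.

Lemma is_diff_chart0 : is_diff (0, 0) f (fun=> 0).
Proof.
apply: is_diff_ext (is_diff_chart (chart_origin ch)) _ => h.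
by rewrite (jet10 (chart_jet ch)) (jet01 (chart_jet ch)) !mulr0 addr0.
Qed.

Lemma chart_nearU : \forall s \near ((0, 0) : R * R), U s.
Proof.
by apply: open_nbhs_nbhs; split; [exact: chart_open ch|exact: chart_origin ch].
Qed.

Lemma graph_point0 : graph_point P E f (0, 0) = P.
Proof.
rewrite /graph_point chart_value0 (_ : vec3 _ _ _ = 0) ?mul0mx ?addr0//.
by apply/rowP; apply: I3P; rewrite vec3E mxE.
Qed.

Lemma graph_point_in :
  \forall s \near ((0, 0) : R * R), S (graph_point P E f s).
Proof.
have c : is_diff ((0, 0) : R * R) (fun s => vec3 s.1 s.2 (f s)) _ :=
  is_diff_vec3 (is_diff_fst _) (is_diff_snd _) is_diff_chart0.
have : \forall s \near ((0, 0) : R * R), S (P + vec3 s.1 s.2 (f s) *m E) <->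
    vec3 s.1 s.2 (f s) 0 2 = f (vec3 s.1 s.2 (f s) 0 0, vec3 s.1 s.2 (f s) 0 1).
  apply: (near_is_diff (X := fun q => S (P + q *m E) <-> q 0 2 = f (q 0 0, q 0 1)) c).
  rewrite /= chart_value0 (_ : vec3 0 0 0 = 0); first exact: chart_graph ch.
  by apply/rowP; apply: I3P; rewrite vec3E mxE.
by apply: filterS => -[a b]; rewrite !vec3E /= => H; apply/H.
Qed.

Lemma is_diff_local_coord Q :
  is_diff Q (fun Q => (Q - P) *m invmx E) (mulmxr (invmx E)).
Proof. by apply/is_diff_mulmxr/is_diff_subr; exact: is_diff_id. Qed.

Lemma near_local_coord (X : 'rV[R]_3 -> Prop) :
  (\forall q \near (0 : 'rV[R]_3), X q) ->
  \forall Q \near P, X ((Q - P) *m invmx E).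
Proof.
move=> nX; apply: (near_is_diff (is_diff_local_coord P)).
by rewrite subrr mul0mx.
Qed.

Lemma chart_cover : \forall Q \near P, S Q ->
  Q = graph_point P E f (chart_coord Q).
Proof.
apply: filterS (near_local_coord (chart_graph ch)) => Q.
rewrite mulmxKV ?(chart_unit ch)// addrC subrK => H /H e.
rewrite /graph_point /chart_coord /= -e -vec3_eta mulmxKV ?(chart_unit ch)//.
by rewrite addrC subrK.
Qed.

(** Along the curve the third frame coordinate is [f] of the other two, and the differential of [f]
    vanishes at the origin. *)
Lemma curve_tangent_coord (c : R -> 'rV[R]_3) v : is_derive (0 : R) 1 c v ->
  c 0 = P -> (\forall t \near (0 : R), S (c t)) -> (v *m invmx E) 0 2 = 0.
Proof.
move=> cv c0 cS.
pose q t := (c t - P) *m invmx E.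
have qv : is_derive (0 : R) 1 q (v *m invmx E).
  exact: is_derive_comp_curve (is_diff_local_coord _) cv.
have qi i : is_derive (0 : R) 1 (fun t => q t 0 i) ((v *m invmx E) 0 i).
  exact: is_derive_comp_curve (is_diff_coord _ _ _) qv.
have q0 : q 0 = 0 by rewrite /q c0 subrr mul0mx.
have qf : is_derive (0 : R) 1 (fun t => f (q t 0 0, q t 0 1)) 0.
  have p : is_derive (0 : R) 1 (fun t => (q t 0 0, q t 0 1))
      ((v *m invmx E) 0 0, (v *m invmx E) 0 1).
    apply/is_derive_is_diff; apply: is_diff_pair; exact/is_derive_is_diff.
  apply: (is_derive_comp_curve (df := fun=> 0) _ p).
  by rewrite q0 !mxE; exact: is_diff_chart0.
have E0 : \forall t \near (0 : R), q t 0 2 = f (q t 0 0, q t 0 1).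
  have : \forall t \near (0 : R), S (P + q t *m E) <-> q t 0 2 = f (q t 0 0, q t 0 1).
    apply: (near_is_diff ((is_derive_is_diff _ _ _).1 qv)
      (X := fun q => S (P + q *m E) <-> q 0 2 = f (q 0 0, q 0 1))).
    by rewrite q0; exact: chart_graph ch.
  apply: filterS2 cS => t St H; apply/H.
  by rewrite mulmxKV ?(chart_unit ch)// addrC subrK.
have := near_eq_derive (1 : R) E0.
by rewrite (@derive_val _ _ _ _ _ _ _ (qi 2)) (@derive_val _ _ _ _ _ _ _ qf).
Qed.

Lemma tangent_chart v : tangent S P v <-> (v *m invmx E) 0 2 = 0.
Proof.
split=> [[c [cs c0 cS <-]]|v0].
  apply: curve_tangent_coord c0 cS; apply/derivableP/diff_derivable.
  exact: nbhs_singleton (smooth_at_differentiable cs).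
set w := v *m invmx E in v0.
pose l (t : R) := t *: (w 0 0, w 0 1).
have dl t : is_diff t l l by exact: is_diff_scalel.
have fl : smooth_at 0 (fun t => f (l t)).
  apply: (smooth_at_comp_affine dl); rewrite /l scale0r.
  exists U; last exact: chart_smooth ch.
  by split; [exact: chart_open ch|exact: chart_origin ch].
(* The lift to the graph of a line through the origin of the chart, split into an affine map and a
   multiple of [e_3] so that its smoothness follows from the closure properties above. *)
exists (fun t => (P + t *: (w 0 0 *: row 0 E + w 0 1 *: row 1 E)) + f (l t) *: row 2 E).
have dlin t : is_diff t (fun t : R => P + t *: (w 0 0 *: row 0 E + w 0 1 *: row 1 E))
    (fun t => t *: (w 0 0 *: row 0 E + w 0 1 *: row 1 E)).
  by apply: is_diff_addl; exact: is_diff_scalel.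
have cE t : (P + t *: (w 0 0 *: row 0 E + w 0 1 *: row 1 E)) + f (l t) *: row 2 E
    = graph_point P E f (l t).
  rewrite /graph_point vec3_mul -[(l t).1]/(t * w 0 0) -[(l t).2]/(t * w 0 1).
  by rewrite -!scalerA -scalerDr addrA.
split.
- apply: smooth_at_add; first exact: smooth_at_affine dlin.
  have ds (y : R) : is_diff y (fun y : R => y *: row 2 E) (fun y : R => y *: row 2 E).
    exact: is_diff_scalel.
  exact: (smooth_at_linear_comp ds ds fl).
- by rewrite cE /l scale0r graph_point0.
- suff : \forall t \near (0 : R), S (graph_point P E f (l t)).
    by apply: filterS => t; rewrite cE.
  have l0 : l 0 = (0, 0) by rewrite /l scale0r.
  apply: (near_is_diff (dl 0) (X := fun s => S (graph_point P E f s))).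
  by rewrite l0; exact: graph_point_in.
- under eq_fun do rewrite cE.
  have Dg := is_diff_graph_point P E is_diff_chart0.
  have l0 : l 0 = (0, 0) by rewrite /l scale0r.
  rewrite -l0 in Dg; rewrite (is_diff_derive _ (is_diff_comp_fun (dl 0) Dg)) /=.
  rewrite -[v](mulmxKV (chart_unit ch)) -/w [in RHS](vec3_eta w) v0.
  by rewrite -![_ *: _]/(_ * _) !mul1r.
Qed.

End Chart.
End Charts.

(** * Structure equations of a moving frame *)

Section StructureEquations.
Context {R : realType}.
Implicit Types (S : set 'rV[R]_3) (P Q v : 'rV[R]_3) (I : nat -> nat -> R).

(* [Om i j] is the [e_j]-component of [de_i] in the direction [w1 e_1 + w2 e_2].
   The equations are those of degree 1, 2 and 3 in the tangent vector [v]: each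
   is an equality of binary forms, hence encodes several linear equations. *)
Definition structure_eqs (w1 w2 : R) I (Om : 'M[R]_3) : Prop :=
  forall v1 v2 : R,
  let a := v1 * Om 0 0 + v2 * Om 1 0 in
  let b := v1 * Om 0 1 + v2 * Om 1 1 in
  let m := v1 ^+ 2 + v2 ^+ 2 in
  [/\ v1 * Om 0 2 + v2 * Om 1 2 = v1 * w1 + v2 * w2,
      m * Om 2 2 = (v1 ^+ 2 - v2 ^+ 2) * w1 - 2 * v1 * v2 * w2
        + 2 * (v1 * a + v2 * b) &
      (v1 ^+ 3 - 3 * v1 * v2 ^+ 2) * Om 2 2 =
        v1 ^+ 3 * (w1 * I 4%N 0%N + w2 * I 3%N 1%N)
        + 3 * v1 ^+ 2 * v2 * (w1 * I 3%N 1%N + w2 * I 2%N 2%N)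
        + 3 * v1 * v2 ^+ 2 * (w1 * I 2%N 2%N + w2 * I 1%N 3%N)
        + v2 ^+ 3 * (w1 * I 1%N 3%N + w2 * I 0%N 4%N)
        + 3 * (v1 ^+ 2 - v2 ^+ 2) * a - 6 * v1 * v2 * b
        + 3 * m * (v1 * Om 2 0 + v2 * Om 2 1)].

(** The goal [G] is a parameter so that [da] and [db] can be left open: the differentiation rules
    find them by unification before the resulting equation is used. *)
Lemma derive_unique_at (a b : R -> R) (da db t : R) (G : Prop) :
  (\forall s \near t, a s = b s) -> is_derive t 1 a da -> is_derive t 1 b db ->
  (da = db -> G) -> G.
Proof.
move=> ab aa bb; apply; rewrite -(@derive_val _ _ _ _ _ _ _ aa).
by rewrite -(@derive_val _ _ _ _ _ _ _ bb); exact: near_eq_derive.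
Qed.

Lemma is_derive_exp_fun n (f : R -> R) df (t : R) : is_derive t 1 f df ->
  is_derive t 1 (fun s => f s ^+ n.+1) (n.+1%:R * f t ^+ n * df).
Proof.
move=> ft; elim: n => [|n IHn].
  by apply: is_derive_eq ft _; rewrite expr0 !mul1r.
under eq_fun do rewrite exprS.
apply: is_derive_eq (is_derive_mul_fun ft IHn) _.
by rewrite exprS -[n.+2]addn1 natrD; ring.
Qed.

Ltac derive_arith := repeat first [exact: is_derive_cst_fun | eassumption
  | apply: is_derive_add_fun | apply: is_derive_mul_fun
  | apply: is_derive_exp_fun].

(** [graph_curve_jet] is applied at every point of a curve in [S] with velocity [w1 e_1 + w2 e_2];
    the three identities so obtained hold for all small [t] and are differentiated at [t = 0]. *)
Lemma frame_structure S (Ef : 'rV[R]_3 -> 'M[R]_3) Iv P (Et dE : 'rV[R]_3 -> 'M[R]_3)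
    (w1 w2 : R) :
  coefficients S Ef Iv -> S P -> is_diff P Et dE ->
  (\forall Q \near P, S Q -> Et Q = Ef Q) ->
  structure_eqs w1 w2 (Iv P) (dE (vec3 w1 w2 0 *m Ef P) *m invmx (Ef P)).
Proof.
move=> hI SP dEt EtE v1 v2.
have [f [U ch]] := normal_form_chart (hI P SP).
have E0u := chart_unit ch; set E0 := Ef P in ch E0u *.
pose sg (t : R) : R * R := t *: (w1, w2).
have dsg t : is_diff t sg sg by exact: is_diff_scalel.
have sg0 : sg 0 = (0, 0) by rewrite /sg scale0r.
pose r t := graph_point P E0 f (sg t).
have dr : is_derive (0 : R) 1 r (vec3 w1 w2 0 *m E0).
  have Dg := is_diff_graph_point P E0 (is_diff_chart0 ch).
  rewrite -sg0 in Dg; apply: is_derive_eq (is_derive_comp_curve Dg _) _.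
    by apply/is_derive_is_diff; exact: dsg.
  by [].
have r0 : r 0 = P by rewrite /r sg0 (graph_point0 ch).
(* The rows of [N t] are the frame vectors at [r t] in terms of the frame at [P]; so [N 0] is the
   identity and the derivative of [N] at [0] is [Om]. *)
pose N t := Et (r t) *m invmx E0.
have EtP : Et P = E0 by apply: (nbhs_singleton EtE).
have N0 : N 0 = 1%:M by rewrite /N r0 EtP mulmxV.
set Om := dE _ *m _.
have dN : is_derive (0 : R) 1 N Om.
  have dEt' : is_diff (r 0) Et dE by rewrite r0.
  exact: (is_derive_comp_curve (is_diff_mulmxr (invmx E0) dEt') dr).
have dNi i j : is_derive (0 : R) 1 (fun t => N t i j) (Om i j).
  exact: is_derive_comp_curve (is_diff_coord _ _ _) dN.
have nS : \forall t \near (0 : R), S (r t).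
  apply: (near_is_diff (dsg 0) (X := fun s => S (graph_point P E0 f s))).
  by rewrite sg0; exact: graph_point_in ch.
have nE : \forall t \near (0 : R), S (r t) -> Et (r t) = Ef (r t).
  apply: (near_is_diff ((is_derive_is_diff _ _ _).1 dr)
    (X := fun Q => S Q -> Et Q = Ef Q)).
  by rewrite r0.
have nU : \forall t \near (0 : R), U (sg t).
  apply: (near_is_diff (dsg 0)); rewrite sg0; exact: chart_nearU ch.
(* The graph description centred at [P] is needed on a whole neighbourhood of each nearby point of
   the surface, where it meets the description in the frame of that point. *)
have nG : \forall t \near (0 : R), \forall q \near vec3 (sg t).1 (sg t).2 (f (sg t)),
    S (P + q *m E0) <-> q 0 2 = f (q 0 0, q 0 1).
  have c := is_diff_vec3 (is_diff_fst (0, 0)) (is_diff_snd (0, 0)) (is_diff_chart0 ch).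
  rewrite -sg0 in c.
  apply: (near_is_diff (is_diff_comp_fun (dsg 0) c)
    (X := fun q0 => \forall q \near q0, S (P + q *m E0) <-> q 0 2 = f (q 0 0, q 0 1))).
  rewrite sg0 /= (chart_value0 ch) (_ : vec3 0 0 0 = 0).
    exact: near_join (chart_graph ch).
  by apply/rowP; apply: I3P; rewrite vec3E mxE.
pose p i j t := pd f i j (t * w1, t * w2).
pose x1 t := v1 * N t 0 0 + v2 * N t 1 0.
pose y1 t := v1 * N t 0 1 + v2 * N t 1 1.
pose z1 t := v1 * N t 0 2 + v2 * N t 1 2.
pose m := v1 ^+ 2 + v2 ^+ 2.
pose k := v1 ^+ 3 - 3 * v1 * v2 ^+ 2.
have J : \forall t \near (0 : R),
  [/\ z1 t = x1 t * p 1%N 0%N t + y1 t * p 0%N 1%N t,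
      m * N t 2 2 = x1 t ^+ 2 * p 2%N 0%N t + 2 * x1 t * y1 t * p 1%N 1%N t
        + y1 t ^+ 2 * p 0%N 2%N t
        + m * (N t 2 0 * p 1%N 0%N t + N t 2 1 * p 0%N 1%N t) &
      k * N t 2 2 = x1 t ^+ 3 * p 3%N 0%N t + 3 * x1 t ^+ 2 * y1 t * p 2%N 1%N t
        + 3 * x1 t * y1 t ^+ 2 * p 1%N 2%N t + y1 t ^+ 3 * p 0%N 3%N t
        + 3 * m * (x1 t * N t 2 0 * p 2%N 0%N t
                   + (x1 t * N t 2 1 + N t 2 0 * y1 t) * p 1%N 1%N t
                   + y1 t * N t 2 1 * p 0%N 2%N t)
        + k * (N t 2 0 * p 1%N 0%N t + N t 2 1 * p 0%N 1%N t)].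
  near=> t.
  have St : S (r t) by near: t.
  have EtE' : Et (r t) = Ef (r t) by move: St; near: t.
  have Ut : U (sg t) by near: t.
  have [g [U' ch']] := normal_form_chart (hI _ St).
  have dl (s : R) : is_diff s (fun s : R => s *: (v1, v2)) (fun s : R => s *: (v1, v2)).
    exact: is_diff_scalel.
  have nS' : \forall s \near (0 : R), S (graph_point (r t) (Ef (r t)) g (s *: (v1, v2))).
    apply: (near_is_diff (dl 0) (X := fun s => S (graph_point (r t) (Ef (r t)) g s))).
    by rewrite scale0r; exact: graph_point_in ch'.
  (* Coordinates in the frame at [P] of the point that lies above [s v] on the graph at [r t]. *)
  pose q s := vec3 (sg t).1 (sg t).2 (f (sg t)) +
    vec3 (s * v1) (s * v2) (g (s * v1, s * v2)) *m N t.
  have qE s : graph_point (r t) (Ef (r t)) g (s *: (v1, v2)) = P + q s *m E0.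
    rewrite /graph_point -EtE' /q mulmxDl -mulmxA /N mulmxKV// addrA.
    by rewrite -/(graph_point P E0 f (sg t)).
  have nq : \forall s \near (0 : R), S (P + q s *m E0) <-> q s 0 2 = f (q s 0 0, q s 0 1).
    have Dg0 := is_diff_chart0 ch'.
    have c := is_diff_vec3 (is_diff_fst (0, 0)) (is_diff_snd (0, 0)) Dg0.
    have dl0 : ((0 : R) *: (v1, v2) : R * R) = (0, 0) by rewrite scale0r.
    rewrite -dl0 in c.
    have c' := is_diff_addl (vec3 (sg t).1 (sg t).2 (f (sg t)))
      (is_diff_mulmxr (N t) (is_diff_comp_fun (dl 0) c)).
    apply: (near_is_diff c'
      (X := fun q => S (P + q *m E0) <-> q 0 2 = f (q 0 0, q 0 1))).
    rewrite scale0r /= (chart_value0 ch') (_ : vec3 0 0 0 = 0).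
      by rewrite mul0mx addr0; near: t.
    by apply/rowP; apply: I3P; rewrite vec3E mxE.
  apply: (graph_curve_jet (g := g) (z0 := f (t * w1, t * w2))
    (chart_open ch) (chart_smooth ch) Ut
    (chart_open ch') (chart_smooth ch') (chart_origin ch') (chart_jet ch')).
  apply: filterS2 nS' nq => s; rewrite qE => Ss [H _]; have {H} := H Ss.
  have qj j : q s 0 j = vec3 (t * w1) (t * w2) (f (t * w1, t * w2)) 0 j +
      s * (v1 * N t 0 j + v2 * N t 1 j) + g (s * v1, s * v2) * N t 2 j.
    by rewrite mxE mulmx3 !vec3E mulrDr !mulrA addrA.
  by rewrite !qj !vec3E.
have x10 : x1 0 = v1 by rewrite /x1 N0 !mxE /= mulr1 mulr0 addr0.
have y10 : y1 0 = v2 by rewrite /y1 N0 !mxE /= mulr1 mulr0 add0r.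
have N20 : N 0 2 0 = 0 by rewrite N0 mxE.
have N21 : N 0 2 1 = 0 by rewrite N0 mxE.
have N22 : N 0 2 2 = 1 by rewrite N0 mxE.
have dlc (a b : R) j : is_derive (0 : R) 1 (fun t => a * N t 0 j + b * N t 1 j)
    (a * Om 0 j + b * Om 1 j).
  apply: is_derive_eq (is_derive_add_fun
   (is_derive_mul_fun (is_derive_cst_fun a 0) (dNi 0 j))
   (is_derive_mul_fun (is_derive_cst_fun b 0) (dNi 1 j))) _; ring.
have dx1 : is_derive (0 : R) 1 x1 (v1 * Om 0 0 + v2 * Om 1 0) by exact: dlc.
have dy1 : is_derive (0 : R) 1 y1 (v1 * Om 0 1 + v2 * Om 1 1) by exact: dlc.
have dz1 : is_derive (0 : R) 1 z1 (v1 * Om 0 2 + v2 * Om 1 2) by exact: dlc.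
(* Here the order rises by one: the derivatives of the third-order [p i j] are the order-4
   coefficients at [P]. *)
have dp i j : is_derive (0 : R) 1 (p i j)
    (w1 * pd f i.+1 j (0, 0) + w2 * pd f i j.+1 (0, 0)).
  have D := is_diff_pd i j (chart_open ch) (chart_smooth ch) (chart_origin ch).
  rewrite -sg0 in D.
  have := is_derive_comp_curve D ((is_derive_is_diff _ _ _).2 (dsg 0)).
  by rewrite sg0.
have p0 i j : p i j 0 = pd f i j (0, 0) by rewrite /p !mul0r.
have JI := chart_jet ch.
clearbody x1 y1 z1 p N Om.
have dN20 := dNi 2 0; have dN21 := dNi 2 1; have dN22 := dNi 2 2.
have [dp10 dp01] := (dp 1%N 0%N, dp 0%N 1%N).
have [dp20 dp11] := (dp 2%N 0%N, dp 1%N 1%N); have dp02 := dp 0%N 2%N.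
have [dp30 dp21] := (dp 3%N 0%N, dp 2%N 1%N).
have [dp12 dp03] := (dp 1%N 2%N, dp 0%N 3%N).
have J1 := @filterS _ _ (nbhs_filter (0 : R)) _ _ (fun t '(And3 e _ _) => e) J.
have J2 := @filterS _ _ (nbhs_filter (0 : R)) _ _ (fun t '(And3 _ e _) => e) J.
have J3 := @filterS _ _ (nbhs_filter (0 : R)) _ _ (fun t '(And3 _ _ e) => e) J.
have sc (a b : R) : a *: b = a * b by [].
split.
- eapply (derive_unique_at J1); [derive_arith|derive_arith|].
  rewrite !x10 !y10 !p0 (jet10 JI) (jet01 JI) (jet20 JI) (jet11 JI) (jet02 JI).
  by rewrite !sc => ->; ring.
- eapply (derive_unique_at J2); [derive_arith|derive_arith|].
  rewrite !x10 !y10 !N20 !N21 !N22 !p0 (jet10 JI) (jet01 JI) (jet20 JI) (jet11 JI)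
    (jet02 JI) (jet30 JI) (jet21 JI) (jet12 JI) (jet03 JI).
  by rewrite !sc /m /k => D; apply: etrans (etrans _ D) _; ring.
eapply (derive_unique_at J3); [derive_arith|derive_arith|].
rewrite !x10 !y10 !N20 !N21 !N22 !p0 (jet10 JI) (jet01 JI) (jet20 JI) (jet11 JI)
    (jet02 JI) (jet30 JI) (jet21 JI) (jet12 JI) (jet03 JI)
    (jet40 JI) (jet31 JI) (jet22 JI) (jet13 JI) (jet04 JI).
by rewrite !sc /m /k => D; apply: etrans (etrans _ D) _; ring.
Unshelve. all: by end_near.
Qed.

End StructureEquations.

(** * Solution of the structure equations, and constancy from vanishing derivatives *)

Section Uniqueness.
Context {R : realType}.
Implicit Types (S : set 'rV[R]_3) (P Q v : 'rV[R]_3) (I : nat -> nat -> R).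

(** A linear system of nine independent equations for nine unknowns, the forms of degree 1, 2, 3
    having 2, 3, 4 coefficients; four values of [v] recover even the cubic. Here [n] is [Om 2 2],
    and [k] is [Om 1 0 - Om 0 1], the rotation of the frame in the tangent plane. *)
Lemma structure_eqs_solve (w1 w2 : R) I (Om : 'M[R]_3) :
  structure_eqs w1 w2 I Om ->
  let a := I 4%N 0%N in let b := I 3%N 1%N in let c := I 2%N 2%N in
  let d := I 1%N 3%N in let e := I 0%N 4%N in
  let n := - ((a - 3 * c) * w1 + (b - 3 * d) * w2) / 2 in
  let k := ((d - 3 * b) * w1 + (e - 3 * c) * w2) / 6 in
  [/\ Om 0 2 = w1, Om 1 2 = w2 & Om 2 2 = n] /\
  [/\ Om 0 0 = (n - w1) / 2, Om 1 1 = (n + w1) / 2,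
      Om 1 0 = (w2 + k) / 2 & Om 0 1 = (w2 - k) / 2] /\
  [/\ Om 2 0 = - (n - w1) / 2 - (a * w1 + b * w2) / 3 + n / 3 &
      Om 2 1 = (w2 + k) / 2 - (d * w1 + e * w2) / 3].
Proof.
move=> H a b c d e n k.
have [A1 A2 A3] := H 1 0; have [B1 B2 B3] := H 0 1.
have [C1 C2 C3] := H 1 1; have [D1 D2 D3] := H 1 (-1).
move: A1 A2 A3 B1 B2 B3 C1 C2 C3 D1 D2 D3; rewrite {}/n {}/k {}/a {}/b {}/c {}/d {}/e.
move: (I 4%N 0%N) (I 3%N 1%N) (I 2%N 2%N) (I 1%N 3%N) (I 0%N 4%N) => a b c d e.
move: (Om 0 0) (Om 0 1) (Om 0 2) (Om 1 0) (Om 1 1) (Om 1 2) (Om 2 0) (Om 2 1) (Om 2 2).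
move=> o00 o01 o02 o10 o11 o12 o20 o21 o22 *.
by do !split; lra.
Qed.

(* The coefficients [I13] and [I04] are not assumed to agree: the torsion-free
   condition [hcom] forces them to. *)
Lemma structure_unique I I' (Om1 Om2 Om1' Om2' : 'M[R]_3) :
  I' 4%N 0%N = I 4%N 0%N -> I' 3%N 1%N = I 3%N 1%N -> I' 2%N 2%N = I 2%N 2%N ->
  structure_eqs 1 0 I Om1 -> structure_eqs 0 1 I Om2 ->
  structure_eqs 1 0 I' Om1' -> structure_eqs 0 1 I' Om2' ->
  (forall j, Om2' 0 j - Om2 0 j = Om1' 1 j - Om1 1 j) ->
  Om1' = Om1 /\ Om2' = Om2.
Proof.
move=> a4 a3 a2.
move=> /structure_eqs_solve[[A1 A2 A3] [[A4 A5 A6 A7] [A8 A9]]].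
move=> /structure_eqs_solve[[B1 B2 B3] [[B4 B5 B6 B7] [B8 B9]]].
move=> /structure_eqs_solve[[C1 C2 C3] [[C4 C5 C6 C7] [C8 C9]]].
move=> /structure_eqs_solve[[D1 D2 D3] [[D4 D5 D6 D7] [D8 D9]]] hcom.
(* By the solved equations [Om2 0 0 - Om1 1 0] is [2/3] of [I13], and likewise for the primed
   data. *)
have d3 : I' 1%N 3%N = I 1%N 3%N.
  have := hcom 0; rewrite D4 B4 C6 A6 a4 a3 a2; lra.
(* Similarly [Om2 0 1 - Om1 1 1] is [(3 I40 - 6 I22 - I04) / 12], which yields [I04] once [I40] and
   [I22] agree. *)
have d4 : I' 0%N 4%N = I 0%N 4%N.
  have := hcom 1; rewrite D7 B7 C5 A5 a4 a3 a2; lra.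
split; apply/matrixP; apply: I3P; apply: I3P.
all: rewrite ?(C1, C2, C3, C4, C5, C6, C7, C8, C9).
all: rewrite ?(D1, D2, D3, D4, D5, D6, D7, D8, D9).
all: rewrite ?(A1, A2, A3, A4, A5, A6, A7, A8, A9).
all: rewrite ?(B1, B2, B3, B4, B5, B6, B7, B8, B9).
all: by rewrite ?a4 ?a3 ?a2 ?d3 ?d4.
Qed.

Lemma constant_on_ball (H : R * R -> R) (r : R) :
  (forall s u : R * R, `|s| < r ->
    is_derive (0 : R) 1 (fun t : R => H (s + t *: u)) 0) ->
  forall s : R * R, `|s| < r -> H s = H 0.
Proof.
move=> dH s sr.
pose phi (t : R) := H (t *: s).
have dphi (t : R) : `|t| <= 1 -> is_derive t 1 phi 0.
  move=> t1; have ts : `|t *: s| < r.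
    by apply: le_lt_trans sr; rewrite normrZ ler_piMl.
  (* [dH] speaks of parameter [0] on a line through any base point; the base point is moved to
     [t *: s], and writing [0] as [t - t] lets the shift of the parameter compose. *)
  have D : is_diff (t - t) (fun h : R => H (t *: s + h *: s)) (fun h : R => h *: 0).
    by rewrite subrr; apply/is_derive_is_diff; exact: dH.
  have I : is_derive t 1 (fun x : R => x - t) (1 : R).
    apply/is_derive_is_diff.
    apply: is_diff_ext (is_diff_subr t (is_diff_id t)) _ => h.
    exact/esym/mulr1.
  have := is_derive_comp_curve (c := fun x : R => x - t) D I; rewrite scaler0.
  by under eq_fun do rewrite -scalerDl subrKC.
have d (x : R) : x \in `]0, 1[%R -> is_derive x 1 phi 0.
  rewrite in_itv/= => /andP[x0 x1].
  by apply: dphi; rewrite ger0_norm ?ltW.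
have c : {within `[0, 1], continuous phi}.
  apply: derivable_within_continuous => x; rewrite in_itv/= => /andP[x0 x1].
  by have [] := dphi x; rewrite ?ger0_norm.
have [x _] := MVT_segment ler01 d c.
rewrite mul0r /phi scale1r scale0r => /eqP; rewrite subr_eq0 => /eqP.
by [].
Qed.

End Uniqueness.

(** * Rigidity *)

Section ConstantOnSurface.
Context {R : realType}.

Variables (S : set 'rV[R]_3) (H : 'rV[R]_3 -> R).
Hypothesis hS : regular_elliptical S.
(** A vanishing differential, tested on curves in [S] because values of [H] off [S] carry no
    meaning. *)
Hypothesis dH : forall P c v, S P -> is_derive (0 : R) 1 c v -> c 0 = P ->
  (\forall t \near (0 : R), S (c t)) -> is_derive (0 : R) 1 (fun t => H (c t)) 0.

(** Line segments in a disc of the chart lift to curves in [S], along which [H] has zero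
    derivative. *)
Lemma locally_constant P : S P -> \forall Q \near P, S Q -> H Q = H P.
Proof.
move=> SP; have [E [I /normal_form_chart[f [U ch]]]] := hS SP.
have /near_join/nbhs_ballP[r /= r0 rP] : \forall s \near ((0, 0) : R * R),
    U s /\ S (graph_point P E f s).
  by apply: filterS2 (chart_nearU ch) (graph_point_in ch).
have cst_ball (s : R * R) : `|s| < r -> H (graph_point P E f s) = H P.
  move=> sr; rewrite -[in RHS](graph_point0 ch).
  apply: (constant_on_ball (H := fun s => H (graph_point P E f s))) sr => {}s u sr.
  have ns : \forall y \near s, U y /\ S (graph_point P E f y).
    by apply: rP; rewrite -ball_normE/= sub0r normrN.
  have [Us Ss] := nbhs_singleton ns.
  have Dg := is_diff_graph_point P E (is_diff_chart ch Us).
  have dl : is_diff (0 : R) (fun t : R => s + t *: u) (fun t : R => t *: u).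
    by apply: is_diff_addl; exact: is_diff_scalel.
  have l0 : s + (0 : R) *: u = s by rewrite scale0r addr0.
  apply: (dH (P := graph_point P E f s)) => //.
  - by apply: (is_derive_comp_at Dg l0); exact/is_derive_is_diff.
  - by rewrite l0.
  apply: (near_is_diff (X := fun s => S (graph_point P E f s)) dl).
  by rewrite l0; apply: filterS ns => y [].
have nr : \forall Q \near P, `|chart_coord P E Q| < r.
  have D : is_diff P (chart_coord P E) _ :=
    is_diff_pair (is_diff_comp_fun (is_diff_local_coord P E P) (is_diff_coord _ _ _))
      (is_diff_comp_fun (is_diff_local_coord P E P) (is_diff_coord _ _ _)).
  apply: (near_is_diff (X := fun s => `|s| < r) D).
  rewrite /chart_coord subrr mul0mx !mxE; apply/nbhs_ballP; exists r => // y.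
  by rewrite -ball_normE/= sub0r normrN.
apply: filterS2 (chart_cover ch) nr => Q QE Qr /QE ->.
exact: cst_ball.
Qed.

(** By local constancy both a level set of [H] and its complement in [S] are traces of open sets;
    the implications [S Q -> ...] make these sets neighbourhoods in the ambient space. *)
Lemma constant_on_surface : connected S -> forall P Q, S P -> S Q -> H Q = H P.
Proof.
move=> cS P Q SP SQ.
pose A := [set Q | S Q /\ H Q = H P].
suff AS : A = S by have [] : A Q by rewrite AS.
apply: cS; first by exists P.
  exists (interior [set Q | S Q -> H Q = H P]); first exact: open_interior.
  rewrite eqEsubset; split=> [T [ST HT]|T [ST /nbhs_singleton HT]].
    by split=> //; apply: filterS (locally_constant ST) => V /[apply] ->.
  by split=> //; exact: HT.
exists (~` interior [set Q | S Q -> H Q <> H P]).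
  exact/open_closedC/open_interior.
rewrite eqEsubset; split=> [T [ST HT]|T [ST nT]].
  by split=> // /nbhs_singleton/(_ ST).
split=> //; apply: contrapT => HT; apply: nT.
by apply: filterS (locally_constant ST) => V /[apply] ->.
Qed.

End ConstantOnSurface.

(** * Curves in a surface and differentials of maps on it *)

Section TangentMaps.
Context {R : realType}.
Implicit Types (S : set 'rV[R]_3) (P Q v : 'rV[R]_3) (c : R -> 'rV[R]_3).

(** Derivability at [0] replaces the smoothness required in [tangent], so that a differentiable map
    carries such curves to such curves. *)
Definition curve_in S P c v :=
  [/\ is_derive (0 : R) 1 c v, c 0 = P & \forall t \near (0 : R), S (c t)].

Lemma curve_in_tangent S P E I c v :
  normal_form S P E I -> curve_in S P c v -> tangent S P v.
Proof.
move=> /normal_form_chart[f [U ch]] [cv c0 cS].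
by apply/(tangent_chart ch); exact: (curve_tangent_coord ch cv c0 cS).
Qed.

Lemma tangent_curve_in S P v : tangent S P v -> exists c, curve_in S P c v.
Proof.
move=> [c [cs c0 cS <-]]; exists c; split=> //.
by apply/derivableP/diff_derivable; exact: nbhs_singleton (smooth_at_differentiable cs).
Qed.

Lemma curve_in_map (W : normedModType R) S P c v (G H : 'rV[R]_3 -> W) :
  curve_in S P c v -> differentiable G P ->
  (\forall Q \near P, S Q -> G Q = H Q) ->
  is_derive (0 : R) 1 (fun t => H (c t)) ('d G P v).
Proof.
move=> [cv c0 cS] /differentiableP GP GH.
apply: near_eq_is_derive (is_derive_comp_at GP c0 cv).
have : \forall t \near (0 : R), S (c t) -> G (c t) = H (c t).
  apply: (near_is_diff (X := fun Q => S Q -> G Q = H Q)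
    ((is_derive_is_diff _ _ _).1 cv)).
  by rewrite c0.
by apply: filterS2 cS => t St /(_ St).
Qed.

Lemma local_extension_differentiable (W : normedModType R) S (f : 'rV[R]_3 -> W) P g :
  local_extension S f P g -> differentiable g P.
Proof. by move=> [gs _]; exact: nbhs_singleton (smooth_at_differentiable gs). Qed.

(** Any two extensions agree along a curve in [S] with velocity [v], so the choice made by [get] is
    immaterial on tangent vectors. *)
Lemma surf_diffE (W : normedModType R) S (f : 'rV[R]_3 -> W) P v g :
  local_extension S f P g -> tangent S P v -> surf_diff S f P v = 'd g P v.
Proof.
move=> fg /tangent_curve_in[c cv].
have gP : local_extension S f P (get (local_extension S f P)).
  by apply: getPex; exists g.
have D1 := curve_in_map cv (local_extension_differentiable gP) gP.2.
have D2 := curve_in_map cv (local_extension_differentiable fg) fg.2.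
rewrite -(@derive_val _ _ _ _ _ _ _ D2).
by rewrite (@derive_val _ _ _ _ _ _ _ D1).
Qed.

Lemma local_extension_near (W : normedModType R) S (f : 'rV[R]_3 -> W) P g :
  local_extension S f P g -> \forall Q \near P, local_extension S f Q g.
Proof.
move=> [[U [Uo UP] gU] /near_join gf].
have UP' : \forall Q \near P, U Q by exact: open_nbhs_nbhs.
by apply: filterS2 UP' gf => Q UQ gQ; split=> //; exists U.
Qed.

Lemma vec3_mul_unit (x y z : R) (E : 'M[R]_3) v : E \in unitmx ->
  v = x *: row 0 E + y *: row 1 E + z *: row 2 E ->
  v *m invmx E = vec3 x y z.
Proof. by move=> Eu ->; rewrite -vec3_mul mulmxK. Qed.

Lemma tangent_coord S E w1 w2 P v I : dual_forms S E w1 w2 ->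
  normal_form S P (E P) I -> S P -> tangent S P v ->
  v *m invmx (E P) = vec3 (w1 P v) (w2 P v) 0.
Proof.
move=> hw [Eu _] SP /(hw _ _ SP) vE.
by apply: vec3_mul_unit => //; rewrite scale0r addr0.
Qed.

Lemma derive_mixed_mx (V : normedModType R) m n (h : V -> 'M[R]_(m, n)) (x u v : V) :
  (\forall y \near x, derivable h y u) -> (\forall y \near x, derivable h y v) ->
  differentiable ('D_u h) x -> differentiable ('D_v h) x ->
  'D_v ('D_u h) x = 'D_u ('D_v h) x.
Proof.
move=> hu hv gu gv.
have dij w i j : (\forall y \near x, derivable h y w) ->
    \forall y \near x, 'D_w h y i j = 'D_w (fun z => h z i j) y.
  by apply: filterS => y hy; rewrite derive_mx// mxE.
have coord (g : V -> 'M[R]_(m, n)) i j : differentiable g x ->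
    differentiable (fun y => g y i j : R) x.
  by move=> /differentiableP/is_diff_mxP/(_ i j)[].
have diff_ij w i j : (\forall y \near x, derivable h y w) ->
    differentiable ('D_w h) x -> differentiable ('D_w (fun z => h z i j)) x.
  move=> hw gw.
  by have [] := is_diff_eq_near (dij w i j hw) (differentiableP (coord _ i j gw)).
apply/matrixP => i j; rewrite (derive_mx (diff_derivable gu)) mxE.
rewrite (derive_mx (diff_derivable gv)) mxE.
rewrite (near_eq_derive _ (dij u i j hu)) (near_eq_derive _ (dij v i j hv)).
apply: derive_mixed; [| |exact: diff_ij|exact: diff_ij].
  by apply: filterS hu => y /derivable_mxP.
by apply: filterS hv => y /derivable_mxP.
Qed.

End TangentMaps.

(** * The transition matrix between the two frames is stationary *)

Section Rigidity.
Context {R : realType}.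
Variables (S S' : set 'rV[R]_3) (E E' : 'rV[R]_3 -> 'M[R]_3)
  (w1 w2 w1' w2' : @one_form R) (I I' : 'rV[R]_3 -> nat -> nat -> R)
  (F : 'rV[R]_3 -> 'rV[R]_3).
Hypothesis sE : smooth_on S E.
Hypothesis hw : dual_forms S E w1 w2.
Hypothesis hI : coefficients S E I.
Hypothesis sE' : smooth_on S' E'.
Hypothesis hw' : dual_forms S' E' w1' w2'.
Hypothesis hI' : coefficients S' E' I'.
Hypothesis sF : smooth_on S F.
Hypothesis FS : forall P, S P -> S' (F P).
Hypothesis hinv : preserves_invariants S F w1 w2 I w1' w2' I'.

Definition transition P := invmx (E P) *m E' (F P).

(** The image vector is tangent to [S'], and preservation of the forms gives it the same two frame
    components as [v]: the differential sends [e_i] to [e_i']. *)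
Lemma push_curve P c v g : S P -> curve_in S P c v ->
  local_extension S F P g -> 'd g P v = v *m transition P.
Proof.
move=> SP cv gF; have [_ c0 cS] := cv.
have tv := curve_in_tangent (hI SP) cv.
set u := 'd g P v.
have cu : curve_in S' (F P) (fun t => F (c t)) u.
  split; first exact: curve_in_map cv (local_extension_differentiable gF) gF.2.
    by rewrite c0.
  by apply: filterS cS => t; exact: FS.
have tu := curve_in_tangent (hI' (FS SP)) cu.
have [i1 i2 _ _ _] := hinv.
have := i1 P v SP tv; have := i2 P v SP tv.
rewrite /pullback (surf_diffE gF tv) -/u => e2 e1.
have := hw' (FS SP) tu; rewrite e1 e2 => ->.
rewrite /transition mulmxA (tangent_coord hw (hI SP) SP tv) vec3_mul.
by rewrite scale0r addr0.
Qed.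

Lemma transition_stationary P c v : S P -> curve_in S P c v ->
  is_derive (0 : R) 1 (fun t => transition (c t)) 0.
Proof.
move=> SP cv.
have [Et EtP] := sE SP; have [Ft FtP] := sF SP.
have [Et' EtP'] := sE' (FS SP).
have [f [U ch]] := normal_form_chart (hI SP).
have [f' [U' ch']] := normal_form_chart (hI' (FS SP)).
have Au := chart_unit ch; have Bu := chart_unit ch'.
set A := E P in ch Au; set B := E' (F P) in ch' Bu.
have EtA : Et P = A by exact: (nbhs_singleton EtP.2).
have FtA : Ft P = F P by exact: (nbhs_singleton FtP.2).
have EtB : Et' (F P) = B by apply: (nbhs_singleton EtP'.2); exact: FS.
have dEt := differentiableP (local_extension_differentiable EtP).
have dFt := differentiableP (local_extension_differentiable FtP).
have dEt' := differentiableP (local_extension_differentiable EtP').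
(* An extension of [transition] off [S], built from local extensions so that it has a differential
   at [P]. *)
pose Kt Q := invmx (Et Q) *m Et' (Ft Q).
have DK : is_diff P Kt (fun h => - (invmx A *m 'd Et P h *m invmx A) *m B
    + invmx A *m 'd Et' (F P) ('d Ft P h)).
  have EtPu : Et P \in unitmx by rewrite EtA.
  have dEtF : is_diff P (fun Q => Et' (Ft Q)) (fun h => 'd Et' (F P) ('d Ft P h)).
    by apply: is_diff_comp_fun; rewrite FtA.
  by have := is_diff_mulmx (is_diff_invmx EtPu dEt) dEtF; rewrite EtA FtA EtB.
have KtE : \forall Q \near P, S Q -> Kt Q = transition Q.
  have nF : \forall Q \near P, S' (Ft Q) -> Et' (Ft Q) = E' (Ft Q).
    apply: (near_is_diff (X := fun Q => S' Q -> Et' Q = E' Q) dFt).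
    by rewrite FtA; exact: EtP'.2.
  apply: filterS3 EtP.2 FtP.2 nF => Q hEt hFt nF SQ.
  have := nF; rewrite /Kt /transition hEt// hFt// => ->//.
  exact: FS.
have [dKP KPE] := DK.
pose e (x y : R) := vec3 x y 0 *m A; pose e' (x y : R) := vec3 x y 0 *m B.
have eT x y : tangent S P (e x y).
  by apply/(tangent_chart ch); rewrite /e mulmxK// vec3E.
have pushe x y : 'd Ft P (e x y) = e' x y.
  have [b cb] := tangent_curve_in (eT x y).
  by rewrite (push_curve SP cb FtP) /e /e' /transition mulmxA mulmxK.
pose Om x y := 'd Et P (e x y) *m invmx A.
pose Om' x y := 'd Et' (F P) (e' x y) *m invmx B.
have KOm x y : 'd Kt P (e x y) = invmx A *m (Om' x y - Om x y) *m B.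
  rewrite KPE pushe mulmxBr mulmxBl /Om /Om' !mulmxA mulmxKV// mulNmx addrC.
  by [].
have st x y : structure_eqs x y (I P) (Om x y).
  exact: (frame_structure _ _ hI SP dEt EtP.2).
have st' x y : structure_eqs x y (I' (F P)) (Om' x y).
  exact: (frame_structure _ _ hI' (FS SP) dEt' EtP'.2).
(* ['d Kt P] is linear and [v] is a combination of [e 1 0] and [e 0 1], so two directions
   suffice. *)
suff om12 : Om' 1 0 = Om 1 0 /\ Om' 0 1 = Om 0 1.
  have D := curve_in_map cv dKP KtE.
  suff vE : 'd Kt P v = 0 by rewrite -vE.
  have tv := curve_in_tangent (hI SP) cv.
  have -> : v = w1 P v *: e 1 0 + w2 P v *: e 0 1.
    rewrite {1}(hw SP tv) /e !vec3_mul !scale0r !scale1r !addr0 add0r.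
    by [].
  have [om1 om2] := om12.
  have K0 x y : Om' x y = Om x y -> 'd Kt P (e x y) = 0.
    by rewrite KOm => ->; rewrite subrr mulmx0 mul0mx.
  by rewrite linearD 2!linearZ /= !K0// !scaler0 addr0.
have [_ _ a4 a3 a2] := hinv.
apply: (structure_unique (a4 _ SP) (a3 _ SP) (a2 _ SP)) => // j.
(* In [KOm] the left factor [invmx A] turns [e 1 0] and [e 0 1] into the first two basis rows, and
   [B] cancels: what remains is the equality of the two rows of [Om' - Om]. *)
suff comm : e 1 0 *m 'd Kt P (e 0 1) = e 0 1 *m 'd Kt P (e 1 0).
  move: comm; rewrite !KOm /e !mulmxA !mulmxK// => /(congr1 (mulmxr (invmx B))).
  rewrite /= !mulmxK// => /rowP/(_ j).
  have rowE (M : 'M[R]_3) x y : (vec3 x y 0 *m M) 0 j = x * M 0 j + y * M 1 j.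
    by rewrite mulmx3 !vec3E mul0r addr0.
  have subE (M N : 'M[R]_3) i : (M - N) i j = M i j - N i j by rewrite !mxE.
  by rewrite !rowE !subE !mul0r !mul1r addr0 add0r.
pose r := graph_point P A f.
pose rho s := Ft (r s).
pose dr s (h : R * R) := vec3 h.1 h.2 (h.1 * pd f 1 0 s + h.2 * pd f 0 1 s) *m A.
have r0 : r (0, 0) = P by exact: graph_point0 ch.
have Dr s : U s -> is_diff s r (dr s).
  by move=> Us; exact: is_diff_graph_point (is_diff_chart ch Us).
have U0 := chart_origin ch; have D0 := Dr _ U0.
have dr0 h : dr (0, 0) h = e h.1 h.2.
  by rewrite /dr (jet10 (chart_jet ch)) (jet01 (chart_jet ch)) !mulr0 addr0.
have near_r (X : 'rV[R]_3 -> Prop) : (\forall Q \near P, X Q) ->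
    \forall s \near ((0, 0) : R * R), X (r s).
  by move=> XP; apply: near_is_diff D0 _; rewrite r0.
have nS : \forall s \near ((0, 0) : R * R), U s /\ (\forall y \near s, S (r y)).
  by apply: filterS2 (chart_nearU ch) (near_join (graph_point_in ch)).
have nF := near_r _ (local_extension_near FtP); have nK := near_r _ KtE.
(* The relation [dF = dr K] in the chart, at all points near the origin since it is differentiated
   once more. *)
have Drho : \forall s \near ((0, 0) : R * R),
    is_diff s rho (fun h => dr s h *m Kt (r s)).
  apply: filterS3 nS nF nK => s [Us nSs] Fs Ks.
  have Ss : S (r s) := nbhs_singleton nSs.
  have dFs := differentiableP (local_extension_differentiable Fs).
  apply: is_diff_ext (is_diff_comp_fun (Dr s Us) dFs) _ => h.
  rewrite (Ks Ss).
  have dl : is_diff (0 : R) (fun t : R => s + t *: h) (fun t : R => t *: h).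
    by apply: is_diff_addl; exact: is_diff_scalel.
  have l0 : s + (0 : R) *: h = s by rewrite scale0r addr0.
  apply: (push_curve (c := fun t => r (s + t *: h)) Ss _ Fs); split.
  - by apply: (is_derive_comp_at (Dr s Us) l0); exact/is_derive_is_diff.
  - by rewrite l0.
  by apply: (near_is_diff (X := fun s => S (r s)) dl); rewrite l0.
have rE h : \forall s \near ((0, 0) : R * R), dr s h = 'D_h r s.
  by apply: filterS (chart_nearU ch) => s /Dr/(is_diff_derive h).
have rhoE h : \forall s \near ((0, 0) : R * R), 'D_h r s *m Kt (r s) = 'D_h rho s.
  by apply: filterS2 (rE h) Drho => s <- /(is_diff_derive h).
have DDr h : differentiable ('D_h r) (0, 0).
  have dpd i j := is_diff_pd i j (chart_open ch) (chart_smooth ch) U0.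
  have D : is_diff ((0, 0) : R * R) (fun s => dr s h) _ :=
    is_diff_mulmxr A (is_diff_vec3 (is_diff_cst h.1 _) (is_diff_cst h.2 _)
      (is_diffD (is_diffZ h.1 (dpd 1%N 0%N)) (is_diffZ h.2 (dpd 0%N 1%N)))).
  by have [] := is_diff_eq_near (rE h) D.
have DKr : is_diff ((0, 0) : R * R) (fun s => Kt (r s)) (fun h => 'd Kt P (e h.1 h.2)).
  have DK0 : is_diff (r (0, 0)) Kt ('d Kt P) by rewrite r0; exact: differentiableP.
  by apply: is_diff_ext (is_diff_comp_fun D0 DK0) _ => h; rewrite dr0.
(* The product rule: the second derivative of [rho] is that of [r] times [K], plus [e] times the
   differential of [K]. As both second derivatives are symmetric, the extra term is symmetric
   too. *)
have DDrho h : is_diff ((0, 0) : R * R) ('D_h rho) (fun k =>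
    'd ('D_h r) (0, 0) k *m Kt P + e h.1 h.2 *m 'd Kt P (e k.1 k.2)).
  apply: is_diff_eq_near (rhoE h) _.
  apply: is_diff_ext (is_diff_mulmx (differentiableP (DDr h)) DKr) _ => k.
  by rewrite r0 -(nbhs_singleton (rE h)) dr0.
have der_r h : \forall s \near ((0, 0) : R * R), derivable r s h.
  by apply: filterS (chart_nearU ch) => s /Dr[D _]; exact: diff_derivable.
have der_rho h : \forall s \near ((0, 0) : R * R), derivable rho s h.
  by apply: filterS Drho => s [D _]; exact: diff_derivable.
pose u : R * R := (1, 0); pose w : R * R := (0, 1).
have mixed_r := derive_mixed_mx (der_r u) (der_r w) (DDr u) (DDr w).
have [DDu _] := DDrho u; have [DDw _] := DDrho w.
have mixed_rho := derive_mixed_mx (der_rho u) (der_rho w) DDu DDw.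
have Ew := is_diff_derive w (DDrho u); have Eu := is_diff_derive u (DDrho w).
have key (x y x1 y1 M N : 'rV[R]_3) (K : 'M[R]_3) :
    x = M *m K + x1 -> y = N *m K + y1 -> x = y -> M = N -> x1 = y1.
  by move=> -> -> xy MN; move: xy; rewrite MN => /addrI.
have rw := deriveE w (DDr u); have ru := deriveE u (DDr w).
have {}mixed_r := etrans (esym rw) (etrans mixed_r ru).
exact: (key _ _ _ _ _ _ _ Ew Eu mixed_rho mixed_r).
Qed.

End Rigidity.

(** * From a stationary transition matrix to an affine map *)

Section Direct.
Context {R : realType}.

Lemma mx_constant_on_surface m n (S : set 'rV[R]_3) (H : 'rV[R]_3 -> 'M[R]_(m, n)) :
  regular_elliptical S -> connected S ->
  (forall P c v, S P -> curve_in S P c v ->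
    is_derive (0 : R) 1 (fun t => H (c t)) 0) ->
  forall P Q, S P -> S Q -> H Q = H P.
Proof.
move=> hS cS dH P Q SP SQ; apply/matrixP => i j.
apply: (constant_on_surface (H := fun P => H P i j) hS _ cS SP SQ).
move=> {SP} {}P c v SP cv c0 cin.
have D := dH P c v SP (And3 cv c0 cin).
apply: is_derive_eq (is_derive_comp_curve (is_diff_coord _ i j) D) _.
by rewrite mxE.
Qed.

Lemma rigidity (S S' : set 'rV[R]_3) (E E' : 'rV[R]_3 -> 'M[R]_3)
    (w1 w2 w1' w2' : @one_form R) (I I' : 'rV[R]_3 -> nat -> nat -> R)
    (F : 'rV[R]_3 -> 'rV[R]_3) :
  regular_elliptical S -> connected S ->
  smooth_on S E -> dual_forms S E w1 w2 -> coefficients S E I ->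
  smooth_on S' E' -> dual_forms S' E' w1' w2' -> coefficients S' E' I' ->
  smooth_on S F -> (forall P, S P -> S' (F P)) ->
  preserves_invariants S F w1 w2 I w1' w2' I' ->
  exists A b, A \in unitmx /\ forall P, S P -> F P = aff A b P.
Proof.
move=> hS cS sE hw hI sE' hw' hI' sF FS hinv.
(* On the empty surface any affine map will do; otherwise a base point fixes the linear part. *)
have [[P0 SP0]|/nonemptyPn S0] := pselect (S !=set0); last first.
  by exists 1%:M, 0; split=> [|P]; [exact: unitmx1|rewrite S0].
pose A := transition E E' F P0.
have TA P : S P -> transition E E' F P = A.
  move=> SP; apply: (mx_constant_on_surface hS cS _ SP0 SP) => Q c v.
  exact: (transition_stationary sE hw hI sE' hw' hI' sF FS hinv).
have FA P : S P -> F P - P *m A = F P0 - P0 *m A.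
  move=> SP; apply: (mx_constant_on_surface (H := fun P => F P - P *m A)
    hS cS _ SP0 SP) => Q c v SQ cv.
  have [g gF] := sF _ SQ.
  have := curve_in_map cv (local_extension_differentiable gF) gF.2.
  rewrite (push_curve hw hI hw' hI' FS hinv SQ cv gF) TA// => DF.
  have [cd _ _] := cv.
  have DA := is_derive_comp_curve (is_diff_mulmxr A (is_diff_id _)) cd.
  by apply: is_derive_eq (is_deriveB DF DA) _; rewrite subrr.
exists A, (F P0 - P0 *m A); split=> [|P SP].
  by rewrite unitmx_mul unitmx_inv (hI _ SP0).1 (hI' _ (FS _ SP0)).1.
by rewrite /aff -(FA P SP) addrC subrK.
Qed.

End Direct.

(** * Affine images *)

Section AffineImage.
Context {R : realType}.

(** Both functions describe the same set near [P], so their germs and hence their derivatives agree;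
    the restriction to order 4 is that of [normal_jet]. *)
Lemma normal_form_unique (S : set 'rV[R]_3) P E I I' :
  normal_form S P E I -> normal_form S P E I' ->
  forall i j, (i + j = 4)%N -> I' i j = I i j.
Proof.
move=> /normal_form_chart[f [U ch]] /normal_form_chart[f' [U' ch']] i j ij.
have ff' : \forall s \near ((0, 0) : R * R), f s = f' s.
  have D := is_diff_vec3 (is_diff_fst (0, 0)) (is_diff_snd (0, 0)) (is_diff_chart0 ch).
  have : \forall s \near ((0, 0) : R * R), S (graph_point P E f s) <->
      vec3 s.1 s.2 (f s) 0 2 = f' (vec3 s.1 s.2 (f s) 0 0, vec3 s.1 s.2 (f s) 0 1).
    apply: (near_is_diff D
      (X := fun q => S (P + q *m E) <-> q 0 2 = f' (q 0 0, q 0 1))).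
    rewrite /= (chart_value0 ch) (_ : vec3 0 0 0 = 0); first exact: chart_graph ch'.
    by apply/rowP; apply: I3P; rewrite vec3E mxE.
  apply: filterS2 (graph_point_in ch) => -[x y] Ss.
  by rewrite !vec3E /= => H; apply/H.
pose p k l := pd f k l (0, 0); pose p' k l := pd f' k l (0, 0).
have pE : p i j = p' i j by exact: nbhs_singleton (pd_near i j ff').
have J : normal_jet p I := chart_jet ch; have J' : normal_jet p' I' := chart_jet ch'.
clearbody p p'; clear -ij pE J J'.
case: i ij pE => [|[|[|[|[|//]]]]]; case: j => [|[|[|[|[|//]]]]] // _.
- by rewrite (jet04 J) (jet04 J').
- by rewrite (jet13 J) (jet13 J').
- by rewrite (jet22 J) (jet22 J').
- by rewrite (jet31 J) (jet31 J').
- by rewrite (jet40 J) (jet40 J').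
Qed.

Variables (S S' : set 'rV[R]_3) (A : 'M[R]_3) (b : 'rV[R]_3).
Hypothesis Au : A \in unitmx.
Hypothesis AS : aff A b @` S = S'.

Lemma affK P : (aff A b P - b) *m invmx A = P.
Proof. by rewrite /aff addrK mulmxK. Qed.

Lemma affVK Q : aff A b ((Q - b) *m invmx A) = Q.
Proof. by rewrite /aff mulmxKV// subrK. Qed.

Lemma aff_image P : S' (aff A b P) <-> S P.
Proof.
rewrite -AS; split=> [[Q SQ /(congr1 (fun Q => (Q - b) *m invmx A))]|SP].
  by rewrite !affK => <-.
by exists P.
Qed.

Lemma is_diff_aff P : is_diff P (aff A b) (mulmxr A).
Proof.
have := is_diff_addl b (is_diff_mulmxr A (is_diff_id P)).
by under eq_fun do rewrite addrC.
Qed.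

Lemma is_diff_aff_inv Q :
  is_diff Q (fun Q => (Q - b) *m invmx A) (mulmxr (invmx A)).
Proof. by apply/is_diff_mulmxr/is_diff_subr; exact: is_diff_id. Qed.

Lemma smooth_at_local_extension (W : normedModType R) (X : set 'rV[R]_3)
    (f : 'rV[R]_3 -> W) P : smooth_at P f -> local_extension X f P f.
Proof. by move=> fP; split=> //; apply: (@filterE _ (nbhs P)). Qed.

Lemma smooth_on_at (W : normedModType R) (X : set 'rV[R]_3) (f : 'rV[R]_3 -> W) :
  (forall P, smooth_at P f) -> smooth_on X f.
Proof. by move=> fs P _; exists f; exact: smooth_at_local_extension. Qed.

Lemma aff_diffeomorphism : diffeomorphism S S' (aff A b).
Proof.
split; first by apply: smooth_on_at => P; exact: smooth_at_affine is_diff_aff.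
exists (fun Q => (Q - b) *m invmx A); split.
- by apply: smooth_on_at => P; exact: smooth_at_affine is_diff_aff_inv.
- by move=> P SP; rewrite affK; split=> //; apply/aff_image.
by move=> Q SQ; rewrite affVK; split=> //; apply/aff_image; rewrite affVK.
Qed.

(** An affine map carrying the frame along leaves frame coordinates unchanged, so the same [f]
    serves for the image. *)
Lemma normal_form_aff P E I :
  normal_form S P E I -> normal_form S' (aff A b P) (E *m A) I.
Proof.
move=> [Eu [f [fs fS fI]]]; split; first by rewrite unitmx_mul Eu.
exists f; split=> //; apply: filterS fS => q H.
rewrite (_ : _ + _ = aff A b (P + q *m E)); first exact: iff_trans (aff_image _) H.
by rewrite /aff mulmxDl mulmxA addrAC.
Qed.

Variables (E : 'rV[R]_3 -> 'M[R]_3) (w1 w2 : @one_form R)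
  (I : 'rV[R]_3 -> nat -> nat -> R).
Hypothesis hE : moving_frame S E.
Hypothesis hw : dual_forms S E w1 w2.
Hypothesis hI : coefficients S E I.

Lemma image_frameE P : image_frame A b E (aff A b P) = E P *m A.
Proof. by rewrite /image_frame affK. Qed.

Lemma image_frame_moving : moving_frame S' (image_frame A b E).
Proof.
have [sE nE] := hE; split=> [Q SQ|Q SQ]; last first.
  have SP : S ((Q - b) *m invmx A) by apply/aff_image; rewrite affVK.
  have [J /normal_form_aff nJ] := nE _ SP.
  by exists J; move: nJ; rewrite affVK.
have SP : S ((Q - b) *m invmx A) by apply/aff_image; rewrite affVK.
have [g [gs gE]] := sE _ SP.
exists (fun Q => g ((Q - b) *m invmx A) *m A); split.
  have dA (M : 'M[R]_3) : is_diff M (fun M => M *m A) (fun M => M *m A).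
    by apply: is_diff_mulmxr; exact: is_diff_id.
  exact: (smooth_at_linear_comp dA dA (smooth_at_comp_affine is_diff_aff_inv gs)).
have := near_is_diff (X := fun P => S P -> g P = E P) (is_diff_aff_inv Q) gE.
apply: filterS => T gT ST; rewrite /image_frame gT//.
by apply/aff_image; rewrite affVK.
Qed.

(** The primed data are any data satisfying the defining conditions, so they are identified by
    uniqueness: components in a basis for the forms, [normal_form_unique] for the coefficients. *)
Lemma aff_preserves_invariants w1' w2' I' :
  dual_forms S' (image_frame A b E) w1' w2' ->
  coefficients S' (image_frame A b E) I' ->
  preserves_invariants S (aff A b) w1 w2 I w1' w2' I'.
Proof.
move=> hw' hI'.
have forms P v : S P -> tangent S P v ->
    w1' (aff A b P) (surf_diff S (aff A b) P v) = w1 P v /\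
    w2' (aff A b P) (surf_diff S (aff A b) P v) = w2 P v.
  move=> SP tv; have SP' : S' (aff A b P) by apply/aff_image.
  have lA :=
    smooth_at_local_extension S (smooth_at_affine P is_diff_aff).
  have dA : 'd (aff A b) P v = v *m A by have [_ ->] := is_diff_aff P.
  rewrite (surf_diffE lA tv) dA.
  have tv' : tangent S' (aff A b P) (v *m A).
    have [c cv] := tangent_curve_in tv.
    have [_ c0 cS] := cv.
    suff : curve_in S' (aff A b P) (fun t => aff A b (c t)) (v *m A).
      exact: curve_in_tangent (hI' _ SP').
    split.
    - rewrite -dA.
      exact: (curve_in_map cv (local_extension_differentiable lA) lA.2).
    - by rewrite c0.
    by apply: filterS cS => t ct; apply/aff_image.
  have := tangent_coord hw' (hI' _ SP') SP' tv'.
  have vE := tangent_coord hw (hI SP) SP tv.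
  have Eu := (hI SP).1.
  have EAu : E P *m A \in unitmx by rewrite unitmx_mul Eu.
  have vAE : v *m A = vec3 (w1 P v) (w2 P v) 0 *m (E P *m A).
    by rewrite mulmxA -vE mulmxKV.
  rewrite image_frameE [in X in X = _ -> _]vAE mulmxK// => e.
  have e0 := congr1 (fun q : 'rV[R]_3 => q 0 0) e.
  have e1 := congr1 (fun q : 'rV[R]_3 => q 0 1) e.
  by move: e0 e1; rewrite !vec3E => -> ->.
have coef P i j : S P -> (i + j = 4)%N -> I' (aff A b P) i j = I P i j.
  move=> SP; have SP' : S' (aff A b P) by apply/aff_image.
  have nf' := hI' _ SP'; rewrite image_frameE in nf'.
  exact: normal_form_unique (normal_form_aff (hI SP)) nf' i j.
split; try by move=> P SP; exact: coef.
  by move=> P v SP /(forms P v SP)[].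
by move=> P v SP /(forms P v SP)[].
Qed.

End AffineImage.

Theorem theorem4p2 (R : realType) (S S' : set 'rV[R]_3)
    (hS : regular_elliptical S) (hS' : regular_elliptical S')
    (cS : connected S) (cS' : connected S')
    (E : 'rV[R]_3 -> 'M[R]_3) (w1 w2 : one_form)
    (I : 'rV[R]_3 -> nat -> nat -> R)
    (hE : moving_frame S E) (hw : dual_forms S E w1 w2)
    (hI : coefficients S E I) :
  (forall (E' : 'rV[R]_3 -> 'M[R]_3) (w1' w2' : one_form)
      (I' : 'rV[R]_3 -> nat -> nat -> R) (F : 'rV[R]_3 -> 'rV[R]_3),
      moving_frame S' E' -> dual_forms S' E' w1' w2' -> coefficients S' E' I' ->
      diffeomorphism S S' F ->
      preserves_invariants S F w1 w2 I w1' w2' I' ->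
      exists (A : 'M[R]_3) (b : 'rV[R]_3),
        A \in unitmx /\ forall P, S P -> F P = aff A b P)
  /\
  (forall (A : 'M[R]_3) (b : 'rV[R]_3),
      A \in unitmx -> aff A b @` S = S' ->
      [/\ diffeomorphism S S' (aff A b),
          moving_frame S' (image_frame A b E) &
          forall (w1' w2' : one_form) (I' : 'rV[R]_3 -> nat -> nat -> R),
            dual_forms S' (image_frame A b E) w1' w2' ->
            coefficients S' (image_frame A b E) I' ->
            preserves_invariants S (aff A b) w1 w2 I w1' w2' I']).
Proof.
split=> [E' w1' w2' I' F hE' hw' hI' [sF [G [_ FS _]]] hinv|A b Au AS].
  apply: (rigidity hS cS hE.1 hw hI hE'.1 hw' hI' sF _ hinv) => P SP.
  by have [] := FS P SP.
split; first exact: aff_diffeomorphism.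
  exact: (image_frame_moving Au AS hE).
by move=> w1' w2' I'; exact: (aff_preserves_invariants Au AS hw hI).
Qed.
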